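(* Let $K$ be a field of characteristic zero, and let $\Lambda$ be any fixed subset of $K$ such that the map $\Lambda\to K/\mathbb{Z}$, $\lambda\mapsto\lambda+\mathbb{Z}$, is a bijection. Each indecomposable, generalized weight $\mathbb{I}_1$-module of finite length is isomorphic to one of the modules below: (1) $K[x]$; (2) $M(n,\lambda)$, where $n\geq 1$ is an integer and $\lambda\in\Lambda$. Moreover, the $\mathbb{I}_1$-modules in this list are pairwise non-isomorphic, indecomposable, generalized weight and of finite length.
   Context: Modules are left modules. $K[x]$ is the polynomial algebra in one variable, $\partial=\frac{d}{dx}$, and $\int:K[x]\to K[x]$ is the $K$-linear map $x^s\mapsto \frac{x^{s+1}}{s+1}$ ($s\geq 0$). $\mathbb{I}_1=K\langle x,\partial,\int\rangle$ is the subalgebra of $\mathrm{End}_K(K[x])$ generated by (multiplication by) $x$, $\partial$ and $\int$; $K[x]$ is an $\mathbb{I}_1$-module via this action. Put $H=\partial x\in\mathbb{I}_1$ (so $H$ sends $x^s$ to $(s+1)x^s$). For $i,j\ge 0$ put $e_{ij}=\int^i\partial^j-\int^{i+1}\partial^{j+1}$; $F=\bigoplus_{i,j\geq 0}Ke_{ij}$ is a two-sided ideal of $\mathbb{I}_1$. The factor algebra $\mathbb{I}_1/F$ is identified with the skew Laurent polynomial algebra $B_1=K[H][\partial,\partial^{-1};\tau]$, where $\tau(H)=H+1$ and $\partial^{\pm1}\alpha=\tau^{\pm1}(\alpha)\partial^{\pm1}$ for $\alpha\in K[H]$, via $\partial\mapsto\partial$, $\int\mapsto\partial^{-1}$, $H\mapsto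 H$; so $B_1$-modules are the same as $\mathbb{I}_1$-modules annihilated by $F$. An $\mathbb{I}_1$-module $M$ is a generalized weight module if $M=\bigoplus_{\lambda\in K}M^\lambda$, where $M^\lambda=\{m\in M \mid (H-\lambda)^k m=0 \text{ for some } k=k(m)\geq 1\}$. For $\lambda\in K$ and $n\geq 1$, $M(n,\lambda)=B_1\otimes_{K[H]}K[H]/((H-\lambda)^n)\cong B_1/B_1(H-\lambda)^n\cong\mathbb{I}_1/(F+\mathbb{I}_1(H-\lambda)^n)$. Indecomposable modules are nonzero. *)

(* Defs.v *)
From HB Require Import structures.
From mathcomp Require Import all_boot all_order all_algebra.
From mathcomp Require Import boolp classical_sets functions.

Set Implicit Arguments.
Unset Strict Implicit.
Unset Printing Implicit Defensive.

Import GRing.Theory.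

Local Open Scope ring_scope.
Local Open Scope quotient_scope.

Section Endomorphisms.
Variables (K : fieldType) (V : lmodType K).

Record endo := Endo { endo_fun : V -> V; endo_linear : linear endo_fun }.

Lemma endoP (u v : endo) : endo_fun u =1 endo_fun v -> u = v.
Proof.
case: u v => [f lf] [g lg] /= /funext fg.
by subst g; congr Endo; apply: Prop_irrelevance.
Qed.

HB.instance Definition _ := gen_eqMixin endo.
HB.instance Definition _ := gen_choiceMixin endo.

Lemma endo0 (u : endo) : endo_fun u 0 = 0.
Proof.
have := endo_linear u 1 0 0; rewrite !scale1r addr0.
by move/(congr1 (fun y => y - endo_fun u 0)); rewrite subrr addrK.
Qed.

Lemma endoD (u : endo) x y : endo_fun u (x + y) = endo_fun u x + endo_fun u y.
Proof. by have := endo_linear u 1 x y; rewrite !scale1r. Qed.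

Lemma endoZ (u : endo) a x : endo_fun u (a *: x) = a *: endo_fun u x.
Proof. by have := endo_linear u a x 0; rewrite endo0 !addr0. Qed.

Lemma endoN (u : endo) x : endo_fun u (- x) = - endo_fun u x.
Proof. by rewrite -scaleN1r endoZ scaleN1r. Qed.

Fact endo_zero_linear : linear (fun _ : V => 0 : V).
Proof. by move=> a x y; rewrite scaler0 addr0. Qed.

Fact endo_opp_linear (u : endo) : linear (fun p => - endo_fun u p).
Proof. by move=> a x y; rewrite endoD endoZ opprD scalerN. Qed.

Fact endo_add_linear (u v : endo) :
  linear (fun p => endo_fun u p + endo_fun v p).
Proof. by move=> a x y; rewrite !endoD !endoZ addrACA scalerDr. Qed.

Fact endo_one_linear : linear (fun p : V => p).
Proof. by []. Qed.

Fact endo_mul_linear (u v : endo) :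
  linear (fun p => endo_fun u (endo_fun v p)).
Proof. by move=> a x y; rewrite !endoD !endoZ. Qed.

Fact endo_scale_linear (c : K) (u : endo) :
  linear (fun p => c *: endo_fun u p).
Proof.
by move=> a x y; rewrite endoD endoZ scalerDr !scalerA [c * a]mulrC.
Qed.

Definition endo_zero := Endo endo_zero_linear.
Definition endo_opp u := Endo (endo_opp_linear u).
Definition endo_add u v := Endo (endo_add_linear u v).
Definition endo_one := Endo endo_one_linear.
Definition endo_mul u v := Endo (endo_mul_linear u v).
Definition endo_scale c u := Endo (endo_scale_linear c u).

Fact endo_addA : associative endo_add.
Proof. by move=> u v w; apply: endoP => p /=; rewrite addrA. Qed.
Fact endo_addC : commutative endo_add.
Proof. by move=> u v; apply: endoP => p /=; rewrite addrC. Qed.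
Fact endo_add0 : left_id endo_zero endo_add.
Proof. by move=> u; apply: endoP => p /=; rewrite add0r. Qed.
Fact endo_addN : left_inverse endo_zero endo_opp endo_add.
Proof. by move=> u; apply: endoP => p /=; rewrite addNr. Qed.

HB.instance Definition _ :=
  GRing.isZmodule.Build endo endo_addA endo_addC endo_add0 endo_addN.

Fact endo_scaleA a b u : endo_scale a (endo_scale b u) = endo_scale (a * b) u.
Proof. by apply: endoP => p /=; rewrite scalerA. Qed.
Fact endo_scale1 : left_id 1 endo_scale.
Proof. by move=> u; apply: endoP => p /=; rewrite scale1r. Qed.
Fact endo_scaleDr : right_distributive endo_scale +%R.
Proof. by move=> a u v; apply: endoP => p /=; rewrite scalerDr. Qed.
Fact endo_scaleDl u : {morph endo_scale^~ u : a b / a + b}.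
Proof. by move=> a b; apply: endoP => p /=; rewrite scalerDl. Qed.

HB.instance Definition _ := GRing.Zmodule_isLmodule.Build K endo
  endo_scaleA endo_scale1 endo_scaleDr endo_scaleDl.

Fact endo_mulA : associative endo_mul.
Proof. by move=> u v w; apply: endoP. Qed.
Fact endo_mul1l : left_id endo_one endo_mul.
Proof. by move=> u; apply: endoP. Qed.
Fact endo_mul1r : right_id endo_one endo_mul.
Proof. by move=> u; apply: endoP. Qed.
Fact endo_mulDl : left_distributive endo_mul +%R.
Proof. by move=> u v w; apply: endoP. Qed.
Fact endo_mulDr : right_distributive endo_mul +%R.
Proof. by move=> u v w; apply: endoP => p /=; rewrite endoD. Qed.

HB.instance Definition _ := GRing.Zmodule_isPzRing.Build endo
  endo_mulA endo_mul1l endo_mul1r endo_mulDl endo_mulDr.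
End Endomorphisms.

Section PolynomialOperators.
Variable K : fieldType.
Implicit Types p q : {poly K}.

Definition int_poly p : {poly K} :=
  \sum_(s < size p) (p`_s / s.+1%:R) *: 'X^(s.+1).

Lemma coef_int_poly p i : (int_poly p)`_i = p`_i.-1 / i%:R.
Proof.
rewrite /int_poly coef_sum.
under eq_bigr => s _ do rewrite coefZ coefXn.
case: i => [|i] /=.
  by rewrite invr0 mulr0 big1 // => s _; rewrite mulr0.
have [lt_ip | le_pi] := ltnP i (size p).
  rewrite (bigD1 (Ordinal lt_ip)) //= eqxx mulr1 big1 ?addr0 // => s ne_si.
  rewrite eqSS [i == s]eq_sym.
  by move: ne_si; rewrite -val_eqE /= => /negPf ->; rewrite mulr0.
rewrite nth_default // mul0r big1 // => s _.
by rewrite eqSS gtn_eqF ?mulr0 // (leq_trans (ltn_ord s)).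
Qed.

Fact polyX_linear : linear (fun p => 'X * p).
Proof. by move=> a p q; rewrite mulrDr scalerAr. Qed.

Fact int_poly_linear : linear int_poly.
Proof.
move=> a p q; apply/polyP => i.
by rewrite coefD coefZ !coef_int_poly coefD coefZ mulrDl mulrA.
Qed.

Fact deriv_linear : linear (@deriv K).
Proof. by move=> a p q; rewrite linearP. Qed.

Definition endo_x : endo {poly K} := Endo polyX_linear.
Definition endo_d : endo {poly K} := Endo deriv_linear.
Definition endo_int : endo {poly K} := Endo int_poly_linear.

Fact endo_poly_neq0 : 1 != 0 :> endo {poly K}.
Proof.
apply/eqP => /(congr1 (fun u => endo_fun u (1 : {poly K}))) /= /eqP.
by rewrite oner_eq0.
Qed.

HB.instance Definition _ :=
  GRing.PzSemiRing_isNonZero.Build (endo {poly K}) endo_poly_neq0.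

Fact endo_poly_scaleAl (a : K) (u v : endo {poly K}) :
  a *: (u * v) = a *: u * v.
Proof. by apply: endoP. Qed.
HB.instance Definition _ :=
  GRing.Lmodule_isLalgebra.Build K (endo {poly K}) endo_poly_scaleAl.
Fact endo_poly_scaleAr (a : K) (u v : endo {poly K}) :
  a *: (u * v) = u * (a *: v).
Proof. by apply: endoP => p /=; rewrite endoZ. Qed.
HB.instance Definition _ :=
  GRing.Lalgebra_isAlgebra.Build K (endo {poly K}) endo_poly_scaleAr.

Definition I1_pred : {pred endo {poly K}} := fun u =>
  `[< forall S : {pred endo {poly K}}, subalg_closed S ->
      endo_x \in S -> endo_d \in S -> endo_int \in S -> u \in S >].

Fact I1_subalg_closed : subalg_closed I1_pred.
Proof.
split.
- by apply/asboolP => S [].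
- move=> a u v /asboolP uI /asboolP vI; apply/asboolP => S SS Sx Sd Si.
  by case: (SS) => _ Slin _; apply: Slin; [apply: uI | apply: vI].
- move=> u v /asboolP uI /asboolP vI; apply/asboolP => S SS Sx Sd Si.
  by case: (SS) => _ _; apply; [apply: uI | apply: vI].
Qed.

HB.instance Definition _ :=
  GRing.isSubalgClosed.Build K (endo {poly K}) I1_pred I1_subalg_closed.
End PolynomialOperators.

Record I1 (K : fieldType) := MkI1 {
  I1val :> endo {poly K};
  I1valP : I1val \in @I1_pred K
}.

HB.instance Definition _ (K : fieldType) := [isSub for @I1val K].
HB.instance Definition _ (K : fieldType) := [Choice of I1 K by <:].
HB.instance Definition _ (K : fieldType) :=
  [SubChoice_isSubAlgebra of I1 K by <:].

Section TheAlgebraI1.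
Variable K : fieldType.

Fact x_subproof : endo_x K \in @I1_pred K.
Proof. by apply/asboolP. Qed.
Fact d_subproof : endo_d K \in @I1_pred K.
Proof. by apply/asboolP. Qed.
Fact int_subproof : endo_int K \in @I1_pred K.
Proof. by apply/asboolP. Qed.

Definition I1x : I1 K := MkI1 x_subproof.
Definition I1d : I1 K := MkI1 d_subproof.
Definition I1int : I1 K := MkI1 int_subproof.
Definition I1H : I1 K := I1d * I1x.

Definition I1e (i j : nat) : I1 K :=
  I1int ^+ i * I1d ^+ j - I1int ^+ i.+1 * I1d ^+ j.+1.

Definition I1F : {pred I1 K} := fun u =>
  `[< exists (n : nat) (c : nat -> nat -> K),
      u = \sum_(i < n) \sum_(j < n) c i j *: I1e i j >].

Lemma I1_ind (S : {pred I1 K}) : subalg_closed S ->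
  I1x \in S -> I1d \in S -> I1int \in S -> forall u, u \in S.
Proof.
case=> S1 Slin Smul Sx Sd Si u.
pose T : {pred endo {poly K}} := fun w =>
  `[< exists2 v : I1 K, v \in S & I1val v = w >].
have : I1val u \in T.
  have /asboolP := I1valP u; apply.
  - split; first by apply/asboolP; exists 1.
    + move=> a _ _ /asboolP[v vS <-] /asboolP[w wS <-]; apply/asboolP.
      by exists (a *: v + w) => //; apply: Slin.
    + move=> _ _ /asboolP[v vS <-] /asboolP[w wS <-]; apply/asboolP.
      by exists (v * w) => //; apply: Smul.
  - by apply/asboolP; exists I1x.
  - by apply/asboolP; exists I1d.
  - by apply/asboolP; exists I1int.
by case/asboolP => v vS /val_inj <-.
Qed.

Lemma F0 : 0 \in I1F.
Proof.
by apply/asboolP; exists 0, (fun _ _ => 0); rewrite big_ord0.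
Qed.

Lemma Fe i j : I1e i j \in I1F.
Proof.
apply/asboolP; exists (i + j).+1, (fun k l => ((k == i) && (l == j))%:R).
have ltin : (i < (i + j).+1)%N by rewrite ltnS leq_addr.
have ltjn : (j < (i + j).+1)%N by rewrite ltnS leq_addl.
rewrite (bigD1 (Ordinal ltin)) //= (bigD1 (Ordinal ltjn)) //= !eqxx scale1r.
rewrite big1 ?addr0 ?big1 ?addr0 // => [k ki | k kj].
  rewrite big1 // => l _; move: ki; rewrite -val_eqE /= => /negPf ->.
  by rewrite scale0r.
by move: kj; rewrite -val_eqE /= => /negPf ->; rewrite scale0r.
Qed.

Lemma sum_widen (n m : nat) (c : nat -> nat -> K) : (n <= m)%N ->
  \sum_(i < n) \sum_(j < n) c i j *: I1e i j =
  \sum_(i < m) \sum_(j < m)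
    (if (i < n)%N && (j < n)%N then c i j else 0) *: I1e i j.
Proof.
move=> nm.
rewrite (big_ord_widen m (fun i => \sum_(j < n) c i j *: I1e i j) nm).
rewrite big_mkcond; apply: eq_bigr => i _.
case: ifP => _ /=; last by rewrite big1 // => j _; rewrite scale0r.
rewrite (big_ord_widen m (fun j => c i j *: I1e i j) nm) big_mkcond.
by apply: eq_bigr => j _; case: ifP => // _; rewrite scale0r.
Qed.

Lemma F_linear a : {in I1F &, forall u v, a *: u + v \in I1F}.
Proof.
move=> _ _ /asboolP[n [c ->]] /asboolP[m [d ->]]; apply/asboolP.
rewrite (sum_widen c (leq_maxl n m)) (sum_widen d (leq_maxr n m)).
exists (maxn n m), (fun i j =>
  a * (if (i < n)%N && (j < n)%N then c i j else 0) +
      (if (i < m)%N && (j < m)%N then d i j else 0)).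
rewrite scaler_sumr -big_split; apply: eq_bigr => i _ /=.
rewrite scaler_sumr -big_split; apply: eq_bigr => j _ /=.
by rewrite scalerA scalerDl.
Qed.

Lemma FD : {in I1F &, forall u v, u + v \in I1F}.
Proof. by move=> u v uF vF; rewrite -[u]scale1r F_linear. Qed.

Lemma FZ a u : u \in I1F -> a *: u \in I1F.
Proof. by move=> uF; rewrite -[a *: u]addr0 F_linear // F0. Qed.

Lemma F_span (u : I1 K) : (forall i j, u * I1e i j \in I1F) ->
  {in I1F, forall f, u * f \in I1F}.
Proof.
move=> ue _ /asboolP[n [c ->]].
rewrite mulr_sumr; apply: (big_ind (fun v => v \in I1F)); first exact: F0.
  exact: FD.
move=> i _; rewrite mulr_sumr.
apply: (big_ind (fun v => v \in I1F)); first exact: F0.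
  exact: FD.
by move=> j _; rewrite -scalerAr FZ.
Qed.

(* In positive characteristic 1 / i is 0 for some i > 0 and F may fail to be a
   left ideal. *)
Hypothesis charK : [pchar K] =i pred0.

Let natK (n : nat) : n.+1%:R != 0 :> K.
Proof. by rewrite (pcharf0P K).1. Qed.

Lemma d_int : I1d * I1int = 1.
Proof.
apply: val_inj; apply: endoP => p /=; apply/polyP => i.
by rewrite coef_deriv coef_int_poly /= -[LHS]mulr_natr mulfVK.
Qed.

Lemma x_int : I1x * I1int = I1int * I1x + I1int * I1int.
Proof.
apply: val_inj; apply: endoP => p /=; apply/polyP => -[|[|i]].
- by rewrite coefD !coef_int_poly !coefXM /= invr0 !mulr0 addr0.
- by rewrite coefD !coef_int_poly !coefXM !coef_int_poly /= invr0 mulr0 !mul0r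
             addr0.
rewrite coefD !coef_int_poly !coefXM !coef_int_poly /= -mulrDl.
set b := p`_i / _; have -> : p`_i = b * i.+1%:R by rewrite mulfVK.
by rewrite mulr_natr -mulrSr -[b *+ _]mulr_natr mulfK.
Qed.

Lemma e_E i j : I1e i j = I1int ^+ i * I1e 0 0 * I1d ^+ j.
Proof.
rewrite /I1e !expr0 !expr1 mulr1 mulrBr mulrBl mulr1; congr (_ - _).
by rewrite exprSr exprS !mulrA.
Qed.

Lemma x_e00 : I1x * I1e 0 0 = I1int * I1e 0 0.
Proof.
rewrite /I1e !expr0 !expr1 mulr1.
apply: val_inj; apply: endoP => p /=.
have -> : p - int_poly p^`() = (p`_0)%:P.
  apply/polyP => -[|i]; rewrite coefB coef_int_poly coefC /=.
    by rewrite invr0 mulr0 subr0.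
  by rewrite coef_deriv -[_ *+ i.+1 in X in _ - X]mulr_natr mulfK ?subrr.
apply/polyP => -[|[|i]].
- by rewrite coefXM coef_int_poly invr0 mulr0.
- by rewrite coefXM coef_int_poly coefC divr1.
- by rewrite coefXM coef_int_poly !coefC /= mul0r.
Qed.

Lemma x_e i j : I1x * I1e i j = i.+1%:R *: I1e i.+1 j.
Proof.
rewrite (e_E i j) (e_E i.+1 j) !mulrA scalerAl; congr (_ * _).
elim: i => [|i IHi]; first by rewrite expr0 mulr1 expr1 scale1r x_e00.
have -> : I1x * I1int ^+ i.+1 * I1e 0 0 =
    I1int * (I1x * I1int ^+ i * I1e 0 0) + I1int * (I1int * I1int ^+ i) * I1e 0 0.
  by rewrite exprS !mulrA x_int !mulrDl.
by rewrite -!exprS IHi -scalerAr mulrA -exprS -[i.+2%:R]natr1 scalerDl scale1r.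
Qed.

Lemma int_e i j : I1int * I1e i j = I1e i.+1 j.
Proof. by rewrite /I1e mulrBr !mulrA -!exprS. Qed.

Lemma d_e i j : I1d * I1e i j = if i is i'.+1 then I1e i' j else 0.
Proof.
case: i => [|i]; last by rewrite -int_e mulrA d_int mul1r.
by rewrite /I1e expr0 mul1r expr1 mulrBr mulrA d_int mul1r -exprS subrr.
Qed.

Lemma F_left_ideal (u : I1 K) : {in I1F, forall f, u * f \in I1F}.
Proof.
pose S : {pred I1 K} := fun u => `[< forall f, f \in I1F -> u * f \in I1F >].
suff : u \in S by move/asboolP.
apply: I1_ind.
- split; first by apply/asboolP => f fF; rewrite mul1r.
  + move=> a v w /asboolP vS /asboolP wS; apply/asboolP => f fF.
    by rewrite mulrDl -scalerAl F_linear ?vS ?wS.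
  + move=> v w /asboolP vS /asboolP wS; apply/asboolP => f fF.
    by rewrite -mulrA vS ?wS.
- by apply/asboolP; apply: F_span => i j; rewrite x_e FZ ?Fe.
- apply/asboolP; apply: F_span => i j; rewrite d_e.
  by case: i => [|i]; [apply: F0 | apply: Fe].
- by apply/asboolP; apply: F_span => i j; rewrite int_e Fe.
Qed.
End TheAlgebraI1.

Section QuotientModule.
Variables (R : pzRingType) (V : lmodType R).

(* An alias of S carrying the proof that it is a submodule. *)
Definition submod_of (S : {pred V}) & submod_closed S := S.

Variables (S : {pred V}) (SP : submod_closed S).

HB.instance Definition _ := GRing.isSubmodClosed.Build R V (submod_of SP) SP.
HB.instance Definition _ := GRing.isZmodClosed.Build V (submod_of SP)
  (GRing.submod_closedB SP).

Definition quot_mod := Quotient.quot (submod_of SP).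

HB.instance Definition _ := GRing.Zmodule.on quot_mod.
HB.instance Definition _ : EqQuotient V (Quotient.equiv (submod_of SP)) quot_mod :=
  EqQuotient.on quot_mod.

Definition quot_scale (a : R) (q : quot_mod) : quot_mod :=
  \pi_quot_mod (a *: repr q).

Lemma quot_mod_eq (u v : V) :
  (\pi_quot_mod u == \pi_quot_mod v) = (u - v \in S).
Proof. by rewrite -Quotient.idealrBE. Qed.

Lemma quot_scale_pi a u :
  quot_scale a (\pi_quot_mod u) = \pi_quot_mod (a *: u).
Proof.
apply/eqP; rewrite /quot_scale quot_mod_eq -scalerBr -/(submod_of SP).
by rewrite rpredZ // -quot_mod_eq reprK.
Qed.

Lemma quot_piD u v :
  \pi_quot_mod (u + v) = \pi_quot_mod u + \pi_quot_mod v.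
Proof. by rewrite (Quotient.pi_add (submod_of SP) u v). Qed.

Fact quot_scaleA a b q : quot_scale a (quot_scale b q) = quot_scale (a * b) q.
Proof.
by elim/quotW: q => u; rewrite (quot_scale_pi b) !quot_scale_pi scalerA.
Qed.
Fact quot_scale1 : left_id 1 quot_scale.
Proof. by elim/quotW => u; rewrite quot_scale_pi scale1r. Qed.
Fact quot_scaleDr : right_distributive quot_scale +%R.
Proof.
move=> a; elim/quotW => u; elim/quotW => v.
by rewrite -quot_piD !quot_scale_pi scalerDr quot_piD.
Qed.
Fact quot_scaleDl q : {morph quot_scale^~ q : a b / a + b}.
Proof.
move=> a b; elim/quotW: q => u.
by rewrite !quot_scale_pi scalerDl quot_piD.
Qed.

HB.instance Definition _ := GRing.Zmodule_isLmodule.Build R quot_mod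
  quot_scaleA quot_scale1 quot_scaleDr quot_scaleDl.
End QuotientModule.

(* A copy of {poly K}, whose own module structure is the one over K. *)
Definition I1poly (K : fieldType) := {poly K}.

Section ModuleKx.
Variable K : fieldType.

HB.instance Definition _ := GRing.Zmodule.on (I1poly K).

Definition I1poly_scale (u : I1 K) (p : I1poly K) : I1poly K :=
  endo_fun (I1val u) p.

Fact I1poly_scaleA u v p :
  I1poly_scale u (I1poly_scale v p) = I1poly_scale (u * v) p.
Proof. by []. Qed.
Fact I1poly_scale1 : left_id 1 I1poly_scale.
Proof. by []. Qed.
Fact I1poly_scaleDr : right_distributive I1poly_scale +%R.
Proof. by move=> u p q; apply: endoD. Qed.
Fact I1poly_scaleDl p : {morph I1poly_scale^~ p : u v / u + v}.
Proof. by []. Qed.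

HB.instance Definition _ := GRing.Zmodule_isLmodule.Build (I1 K) (I1poly K)
  I1poly_scaleA I1poly_scale1 I1poly_scaleDr I1poly_scaleDl.
End ModuleKx.

Section ModuleM.
Variables (K : fieldType) (charK : [pchar K] =i pred0).

(* The left ideal F + I_1 (H - l)^n; M(n, l) is the quotient of I_1 by it. *)
Definition I1FH (n : nat) (l : K) : {pred (I1 K)^o} := fun u =>
  `[< exists f v : I1 K, f \in @I1F K /\ u = f + v * (I1H K - l%:A) ^+ n >].

Fact I1FH_submod_closed n l : submod_closed (I1FH n l).
Proof.
split; first by apply/asboolP; exists 0, 0; rewrite F0 mul0r addr0.
move=> a _ _ /asboolP[f [v [fF ->]]] /asboolP[g [w [gF ->]]].
apply/asboolP; exists (a * f + g), (a * v + w).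
split; first by rewrite FD // F_left_ideal.
by rewrite [a *: _]mulrDr mulrDl mulrA; exact: addrACA.
Qed.

Definition I1M (n : nat) (l : K) := quot_mod (I1FH_submod_closed n l).

HB.instance Definition _ n l := GRing.Lmodule.on (I1M n l).
End ModuleM.

Section Modules.
Variable R : pzRingType.

Definition isomorphic (M N : lmodType R) : Prop :=
  exists f : {linear M -> N}, bijective f.

Definition indecomposable (M : lmodType R) : Prop :=
  (exists m : M, m != 0) /\
  forall A B : {pred M}, submod_closed A -> submod_closed B ->
    (forall m, exists a b, [/\ a \in A, b \in B & m = a + b]) ->
    (forall m, m \in A -> m \in B -> m = 0) ->
    A =i pred1 0 \/ B =i pred1 0.

(* Existence of a composition series 0 = N 0 < N 1 < ... < N n = M; simplicity
   of N i.+1 / N i is expressed as maximality of N i in N i.+1. *)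
Definition finite_length (M : lmodType R) : Prop :=
  exists (n : nat) (N : nat -> {pred M}),
    [/\ N 0 =i pred1 0, N n =i predT,
        forall i, (i <= n)%N -> submod_closed (N i) &
        forall i, (i < n)%N ->
          [/\ {subset N i <= N i.+1}, ~ {subset N i.+1 <= N i} &
              forall L : {pred M}, submod_closed L ->
                {subset N i <= L} -> {subset L <= N i.+1} ->
                L =i N i \/ L =i N i.+1]].
End Modules.

Section GeneralizedWeight.
Variables (K : fieldType) (M : lmodType (I1 K)).

Definition gen_weight_space (l : K) : set M :=
  [set m | exists2 k : nat, (1 <= k)%N & (I1H K - l%:A) ^+ k *: m = 0].

(* The first clause says that M is the sum of its generalized weight spaces, the
   second one that this sum is direct. *)
Definition gen_weight : Prop :=
  (forall m : M, exists (s : seq K) (f : K -> M),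
     [/\ uniq s, forall l, gen_weight_space l (f l) & m = \sum_(l <- s) f l]) /\
  (forall (s : seq K) (f : K -> M), uniq s ->
     (forall l, gen_weight_space l (f l)) -> \sum_(l <- s) f l = 0 ->
     forall l, l \in s -> f l = 0).
End GeneralizedWeight.

Section KmodZ.
Variable K : fieldType.

Definition Zpred : {pred K} := fun a => `[< exists z : int, a = z%:~R >].

Fact Zpred_zmod_closed : zmod_closed Zpred.
Proof.
split; first by apply/asboolP; exists 0.
move=> _ _ /asboolP[y ->] /asboolP[z ->]; apply/asboolP.
by exists (y - z); rewrite rmorphB.
Qed.

HB.instance Definition _ := GRing.isZmodClosed.Build K Zpred Zpred_zmod_closed.

Definition KmodZ := Quotient.quot Zpred.

Definition bij_KmodZ (Lam : set K) : Prop :=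
  set_bij Lam [set: KmodZ] (fun l => \pi_KmodZ l).
End KmodZ.

(* Main.v *)
Require Import Defs.
From HB Require Import structures.
From mathcomp Require Import all_boot all_order all_algebra.
From mathcomp Require Import boolp classical_sets functions.
From mathcomp Require Import zify.

Set Implicit Arguments.
Unset Strict Implicit.
Unset Printing Implicit Defensive.

Import GRing.Theory.
Local Open Scope ring_scope.

(** Write [e] for [I1e 0 0] = 1 - int d, the projection onto constant terms.

    Every generalized weight module M is the direct sum of the submodule of elements
    killed by some power of [d] and of the largest submodule killed by [e]
    ([torsion_flat_split]). The reason is that [e] lives in weight 1 only, while [d]
    lowers weights by 1: applied to a given vector, [e d^j] vanishes for large [j]. An
    indecomposable M is therefore of one of the two types.

    In the first type a vector fixed by [e] generates a copy of K[x], because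
    [r e = (r 1)(x) e] for every operator [r] ([act_e00]). Such a vector exists outside
    any maximal submodule, and K[x] is simple, so M splits as this copy and a maximal
    submodule, and M is K[x] ([torsion_module]).

    In the second type M is killed by F, so it is a module over the skew Laurent
    algebra: every operator acts as a finite sum of terms [shift j] [P_j(H)]
    ([normal_form]), and the shifts are invertible maps between weight spaces. The
    structure of M is then that of one weight space together with the nilpotent
    operator [H - l]; finite length bounds the nilpotency order
    ([finite_length_bound]), and a vector [v] of maximal order generates a direct
    summand, by the usual argument for the longest Jordan block ([jordan_cyclic]). Thus
    M is generated by [v], and the annihilator of [v] is F + I_1 (H - l)^n
    ([cyclic_annihilator]), so M is M(n, l). Weight components are extracted throughout
    by Bezout's identity for polynomials in [H] ([component]).

    Conversely, M(n, l) is generated by a vector of exact order [n]: F and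
    (H - l)^n generate a left ideal in which a polynomial in [H] has to be a multiple
    of (H - l)^n, as seen from the action of operators on large powers of x
    ([symbol_unique], [evalH_I1FH]). Such a cyclic module has the composition series
    of the powers of [H - l], whose smallest nonzero term lies in every nonzero
    submodule, so it is indecomposable. The modules are told apart by the action of F,
    by the class of the weights modulo the integers and by the nilpotency order. *)

(** * Grouping the terms of a sum *)

Section Regroup.
Variables (V : zmodType) (I : Type) (J : eqType).

Lemma big_regroup (w : I -> J) (g : I -> V) (s : seq I) :
  \sum_(i <- s) g i =
  \sum_(j <- undup (map w s)) \sum_(i <- s | w i == j) g i.
Proof.
rewrite (exchange_big_dep predT) //=.
have {1}-> : s = [seq i <- s | w i \in undup (map w s)].
  apply/esym/all_filterP; rewrite all_count; apply/eqP.
  rewrite -[RHS]count_predT -(count_map w (mem (undup (map w s)))).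
  rewrite -[RHS](count_map w predT); apply/eq_in_count => j js /=.
  by rewrite mem_undup js.
rewrite big_filter big_mkcond; apply: eq_bigr => i _ /=.
under eq_bigl => j do rewrite eq_sym.
have [wis | wis] := boolP (w i \in _); last first.
  rewrite big_seq_cond big_pred0 // => j.
  by apply/andP => -[js /eqP eqj]; rewrite -eqj js in wis.
rewrite -big_filter filter_pred1_uniq ?undup_uniq //.
by rewrite big_seq1.
Qed.

End Regroup.

(** * Relations and a normal form in the algebra of integro-differential operators *)

Section Relations.
Variables (K : fieldType) (charK : [pchar K] =i pred0).
Local Notation x := (I1x K).
Local Notation d := (I1d K).
Local Notation i1 := (I1int K).
Local Notation H := (I1H K).
Local Notation e := (I1e K 0 0).

Lemma natS_neq0 (n : nat) : n.+1%:R != 0 :> K.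
Proof. by rewrite (pcharf0P K).1. Qed.

Lemma intr_eq0_char0 (z : int) : (z%:~R == 0 :> K) = (z == 0).
Proof.
case: z => [[|n]|n]; first by rewrite mulr0z eqxx.
  by rewrite -pmulrn (negPf (natS_neq0 n)).
by rewrite NegzE mulrNz oppr_eq0 -pmulrn (negPf (natS_neq0 n)).
Qed.

Lemma intr_inj_char0 : injective (fun z : int => z%:~R : K).
Proof.
move=> y z /= /eqP; rewrite -subr_eq0 -mulrzBr intr_eq0_char0 subr_eq0.
by move/eqP.
Qed.

Lemma e00E : e = 1 - i1 * d.
Proof. by rewrite /I1e !expr0 !expr1 mulr1. Qed.

Lemma e_factor i j : I1e K i j = i1 ^+ i * (e * d ^+ j).
Proof. by rewrite e_E mulrA. Qed.

Lemma d_e00 : d * e = 0.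
Proof. by rewrite (d_e charK 0 0). Qed.

Lemma e00_int : e * i1 = 0.
Proof. by rewrite e00E mulrBl mul1r -mulrA d_int // mulr1 subrr. Qed.

(** With this identity every statement about the three generators reduces to [d],
    the integration and [H], whose commutation rules are shifts of [H]. *)
Lemma xE : x = i1 * H.
Proof.
apply: val_inj; apply: endoP => p /=; apply/polyP => i.
rewrite coef_int_poly coef_deriv /= !coefXM.
case: i => [|i] /=; first by rewrite invr0 mulr0.
by rewrite -[p`_i *+ _]mulr_natr mulfK ?natS_neq0.
Qed.

Lemma d_x : d * x = x * d + 1.
Proof.
apply: val_inj; apply: endoP => p /=.
by rewrite derivM derivX mul1r addrC.
Qed.

Lemma H_d : H * d = d * (H - 1).
Proof. by rewrite /I1H mulrBr mulr1 {2}d_x mulrDr mulr1 addrK mulrA. Qed.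

Lemma d_H : d * H = (H + 1) * d.
Proof. by rewrite mulrDl mul1r H_d mulrBr mulr1 subrK. Qed.

Lemma H_int : H * i1 = i1 * (H + 1).
Proof.
rewrite {1}/I1H -mulrA x_int // mulrDr !mulrA d_int // !mul1r.
by rewrite {1}xE mulrDr mulr1.
Qed.

Lemma H_e00 : H * e = e.
Proof. by rewrite /I1H -mulrA x_e00 // mulrA d_int // mul1r. Qed.

(** [e] projects a polynomial onto its constant term, so its image and its
    coimage are spanned by weight vectors of weight 1. *)
Lemma e00_H : e * H = e.
Proof.
rewrite -[RHS]H_e00 e00E mulrBl mul1r mulrBr mulr1; congr (_ - _).
by rewrite [RHS]mulrA H_int -!mulrA mulrDl mul1r H_d mulrBr mulr1 subrK.
Qed.

(** A representative in the algebra of the [- j]-th power of the invertible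
    generator of the skew Laurent algebra; the sign makes [shift j] raise weights
    by [j]. *)
Definition shift (j : int) : I1 K :=
  match j with Posz k => i1 ^+ k | Negz k => d ^+ k.+1 end.

Lemma H_shift j : H * shift j = shift j * (H + j%:~R%:A).
Proof.
case: j => k /=.
  elim: k => [|k IHk]; first by rewrite expr0 mulr0z scale0r addr0 mulr1 mul1r.
  rewrite exprS mulrA H_int -!mulrA mulrDl mul1r IHk.
  rewrite -[X in _ * (_ + X)]mulr1 -mulrDr -addrA; congr (_ * (_ * (_ + _))).
  by rewrite -!pmulrn -natr1 scalerDl scale1r.
elim: k => [|k IHk].
  by rewrite expr1 H_d NegzE mulrNz scaleNr mulr1z scale1r.
rewrite exprS mulrA H_d -!mulrA mulrBl mul1r IHk.
rewrite -[X in d * (_ - X)]mulr1 -mulrBr.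
congr (_ * (_ * _)).
by rewrite -addrA; congr (_ + _); rewrite !NegzE !mulrNz !scaleNr -opprD
   -!pmulrn -[k.+2%:R]natr1 scalerDl scale1r.
Qed.

Lemma d_shift j : d * shift j = shift (j - 1).
Proof.
case: j => [[|k]|k].
- by rewrite /= mulr1.
- have -> : Posz k.+1 - 1 = k by lia.
  by rewrite /= exprS mulrA d_int // mul1r.
- have -> : Negz k - 1 = Negz k.+1 by lia.
  by rewrite /= -exprS.
Qed.

(** Modulo F, integration inverts the derivation, so [shift] becomes a one-parameter
    group; only for negative [j] is there a defect, which is one of the [I1e 0 k]. *)
Lemma int_shift j : shift (j + 1) - i1 * shift j \in @I1F K.
Proof.
case: j => [k|[|k]].
- have -> : Posz k + 1 = k.+1 by lia.
  by rewrite /= -exprS subrr F0.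
- by rewrite /= expr1 -e00E Fe.
- have -> : Negz k.+1 + 1 = Negz k by lia.
  rewrite /= [d ^+ k.+2]exprS mulrA -[X in X - _]mul1r -mulrBl -e00E.
  by rewrite -[e]mul1r -(expr0 i1) -mulrA -e_factor Fe.
Qed.

(** [I1e i j] is the integration to the power [i], then [e], then [d] to the power
    [j]; right multiplication by a generator moves through the last factor and is
    absorbed by [e], on which [H] acts as 1. *)
Lemma F_right_ideal u : {in @I1F K, forall f, f * u \in @I1F K}.
Proof.
have span (v : I1 K) : (forall i j, I1e K i j * v \in @I1F K) ->
    {in @I1F K, forall f, f * v \in @I1F K}.
  move=> ev _ /asboolP[n [c ->]].
  rewrite mulr_suml; apply: (big_ind (fun w => w \in @I1F K)) => [||k _];
    [exact: F0 | exact: FD |].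
  rewrite mulr_suml; apply: (big_ind (fun w => w \in @I1F K)) => [||l _];
    [exact: F0 | exact: FD |].
  by rewrite -scalerAl FZ.
pose S : {pred I1 K} :=
  fun u => `[< {in @I1F K, forall f, f * u \in @I1F K} >].
have SM : {in S &, forall v w, v * w \in S}.
  move=> v w /asboolP vS /asboolP wS; apply/asboolP => f fF.
  by rewrite mulrA wS ?vS.
have Si : i1 \in S.
  apply/asboolP; apply: span => i [|j].
    by rewrite e_factor expr0 mulr1 -mulrA e00_int mulr0 F0.
  rewrite e_factor exprSr -!mulrA d_int // mulr1 -e_factor; exact: Fe.
have SH : H \in S.
  apply/asboolP; apply: span => i j.
  have -> : I1e K i j * H = (j.+1)%:R *: I1e K i j.
    rewrite e_factor -mulrA scalerAr; congr (_ * _).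
    elim: j => [|j IHj]; first by rewrite expr0 mulr1 e00_H scale1r.
    rewrite exprSr mulrA -mulrA d_H [(H + 1) * d]mulrDl mul1r.
    rewrite [LHS]mulrDr [X in X + _]mulrA IHj.
    by rewrite -scalerAl -[X in _ + X]scale1r -scalerDl natr1.
  by rewrite FZ ?Fe.
suff : u \in S by move/asboolP.
apply: I1_ind => //.
- split=> //; first by apply/asboolP => f fF; rewrite mulr1.
  move=> a v w /asboolP vS /asboolP wS; apply/asboolP => f fF.
  by rewrite mulrDr -scalerAr F_linear ?vS ?wS.
- by rewrite xE SM.
- apply/asboolP; apply: span => i j.
  by rewrite e_factor -!mulrA -exprSr -e_factor Fe.
Qed.

Definition evalH (p : {poly K}) : I1 K := horner_alg (H : I1 K) p.

Lemma evalHX : evalH 'X = H. Proof. exact: horner_algX. Qed.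
Lemma evalHC c : evalH c%:P = c%:A. Proof. exact: horner_algC. Qed.
Lemma evalHD p q : evalH (p + q) = evalH p + evalH q. Proof. exact: rmorphD. Qed.
Lemma evalHB p q : evalH (p - q) = evalH p - evalH q. Proof. exact: rmorphB. Qed.
Lemma evalHM p q : evalH (p * q) = evalH p * evalH q. Proof. exact: rmorphM. Qed.
Lemma evalH1 : evalH 1 = 1. Proof. exact: rmorph1. Qed.
Lemma evalHZ c p : evalH (c *: p) = c *: evalH p.
Proof. by rewrite -mul_polyC evalHM evalHC -scalerAl mul1r. Qed.
Lemma evalHXsubC c k : evalH (('X - c%:P) ^+ k) = (H - c%:A) ^+ k.
Proof. by rewrite /evalH rmorphXn rmorphB /= horner_algX horner_algC. Qed.

Lemma H_sub_shift (mu : K) j k :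
  (H - (mu + j%:~R)%:A) ^+ k * shift j = shift j * (H - mu%:A) ^+ k.
Proof.
have Hs : (H - (mu + j%:~R)%:A) * shift j = shift j * (H - mu%:A).
  rewrite mulrBl H_shift -scalerAl mul1r -[X in _ - X]mulr1 -scalerAl scalerAr.
  by rewrite -mulrBr scalerDl opprD addrACA subrr addr0.
elim: k => [|k IHk]; first by rewrite !expr0 mul1r mulr1.
by rewrite exprSr -mulrA Hs mulrA IHk -mulrA -exprSr.
Qed.

(** The skew Laurent polynomial form of the image of [u] in the quotient by F. The set
    of elements that have such a form contains 1 and is stable under left
    multiplication by each of the generators. *)
Lemma normal_form u : exists (s : seq int) (P : int -> {poly K}) (f : I1 K),
  [/\ uniq s, f \in @I1F K & u = f + \sum_(j <- s) shift j * evalH (P j)].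
Proof.
pose T : {pred I1 K} := fun u => `[< exists s : seq (int * {poly K}),
  u - \sum_(y <- s) shift y.1 * evalH y.2 \in @I1F K >].
suff /asboolP[s sF] : u \in T.
  exists (undup (map fst s)), (fun j => \sum_(y <- s | y.1 == j) y.2),
    (u - \sum_(y <- s) shift y.1 * evalH y.2); split=> //; first exact: undup_uniq.
  rewrite -[X in _ + X](_ : \sum_(y <- s) shift y.1 * evalH y.2 = _) ?subrK //.
  rewrite (big_regroup fst); apply: eq_bigr => j _.
  rewrite [evalH _]rmorph_sum mulr_sumr; apply: eq_bigr => y /eqP <- //.
have TD : {in T &, forall t t', t + t' \in T}.
  move=> t t' /asboolP[s sF] /asboolP[s' s'F]; apply/asboolP; exists (s ++ s').
  by rewrite big_cat opprD addrACA FD.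
have TF f : f \in @I1F K -> f \in T.
  by move=> fF; apply/asboolP; exists [::]; rewrite big_nil subr0.
have Tsh j p : shift j * evalH p \in T.
  by apply/asboolP; exists [:: (j, p)]; rewrite big_seq1 subrr F0.
pose S : {pred I1 K} := fun v => `[< {in T, forall t, v * t \in T} >].
have SM : {in S &, forall v w, v * w \in S}.
  move=> v w /asboolP vS /asboolP wS; apply/asboolP => t tT.
  by rewrite -mulrA vS ?wS.
have TS (v : I1 K) : (forall j p, v * (shift j * evalH p) \in T) -> v \in S.
  move=> vT; apply/asboolP => t /asboolP[s sF].
  rewrite -[t](subrK (\sum_(y <- s) shift y.1 * evalH y.2)) mulrDr mulr_sumr.
  apply: (TD); first by apply/TF/F_left_ideal.
  apply: (big_ind (fun w => w \in T)) => [|w w' wT w'T|[j p] _ /=].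
  - by apply: TF; apply: F0.
  - exact: TD.
  - exact: vT.
have Si : i1 \in S.
  apply: TS => j p; rewrite mulrA.
  have -> : i1 * shift j = shift (j + 1) - (shift (j + 1) - i1 * shift j).
    by rewrite opprB addrC subrK.
  rewrite mulrBl; apply: TD => //; apply: (TF).
  by rewrite -mulNr -scaleN1r F_right_ideal ?FZ ?int_shift.
have SH : H \in S.
  apply: TS => j p; rewrite mulrA H_shift -mulrA -evalHX -evalHC -evalHD -evalHM.
  exact: Tsh.
suff /asboolP/(_ 1) : u \in S.
  by rewrite mulr1; apply; rewrite -[1]mulr1 -{1}[1]/(shift 0) -evalH1.
apply: I1_ind => //.
- split=> //; first by apply/asboolP => t tT; rewrite mul1r.
  move=> a v w /asboolP vS /asboolP wS; apply/asboolP => t tT.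
  rewrite mulrDl TD ?wS // -scalerAl.
  have /asboolP[s sF] := vS _ tT; apply/asboolP.
  exists [seq (y.1, a *: y.2) | y <- s]; rewrite big_map.
  rewrite (_ : \sum_(y <- s) _ = a *: \sum_(y <- s) shift y.1 * evalH y.2).
    by rewrite -scalerBr FZ.
  rewrite scaler_sumr; apply: eq_bigr => y _ /=.
  by rewrite evalHZ scalerAr.
- by rewrite xE SM.
- by apply: TS => j p; rewrite mulrA d_shift.
Qed.
End Relations.

(** * Submodules and cyclic modules over an arbitrary ring *)

Section Submodules.
Variables (R : pzRingType) (M : lmodType R).
Implicit Types (C D : {pred M}) (m : M).

Lemma submod0 D : submod_closed D -> 0 \in D. Proof. by case. Qed.

Lemma submodD D : submod_closed D -> {in D &, forall u v, u + v \in D}.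
Proof. by case=> _ DP u v uD vD; rewrite -[u]scale1r DP. Qed.

Lemma submodZ D a u : submod_closed D -> u \in D -> a *: u \in D.
Proof. by case=> D0 DP uD; rewrite -[_ *: _]addr0 DP. Qed.

Lemma submodB D : submod_closed D -> {in D &, forall u v, u - v \in D}.
Proof. by move=> SD u v uD vD; rewrite -scaleN1r submodD ?submodZ. Qed.

Lemma submod_sum D I (s : seq I) (P : pred I) (g : I -> M) :
  submod_closed D -> (forall i, P i -> g i \in D) ->
  \sum_(i <- s | P i) g i \in D.
Proof.
move=> SD gD; apply: (big_ind (fun m => m \in D)) => //; first exact: submod0.
exact: submodD.
Qed.

Lemma submod_pred1_0 : submod_closed (pred1 (0 : M) : {pred M}).
Proof.
split=> [|a u v]; rewrite !inE // => /eqP -> /eqP ->.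
by rewrite scaler0 addr0.
Qed.

Definition adjoin D m : {pred M} := fun z => `[< exists r : R, z - r *: m \in D >].

Lemma adjoin_closed D m : submod_closed D -> submod_closed (adjoin D m).
Proof.
move=> SD; split; first by apply/asboolP; exists 0; rewrite scale0r subr0 submod0.
move=> a u v /asboolP[r ur] /asboolP[r' vr']; apply/asboolP.
exists (a * r + r'); rewrite scalerDl -scalerA opprD addrACA -scalerBr.
by rewrite submodD ?submodZ.
Qed.

Lemma sub_adjoin D m : {subset D <= adjoin D m}.
Proof. by move=> z zD; apply/asboolP; exists 0; rewrite scale0r subr0. Qed.

Lemma adjoin_gen D m : submod_closed D -> m \in adjoin D m.
Proof. by move=> SD; apply/asboolP; exists 1; rewrite scale1r subrr submod0. Qed.

Lemma adjoin0P m z : reflect (exists r, z = r *: m) (z \in adjoin (pred1 0) m).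
Proof.
apply: (iffP (asboolP _)) => -[r]; rewrite ?inE.
  by rewrite subr_eq0 => /eqP; exists r.
by move=> ->; exists r; rewrite subrr inE.
Qed.

(** A complement of [C], if there is one, is found among the submodules that are
    maximal for meeting [C] in zero. *)
Lemma max_disjoint C : exists W : {pred M},
  [/\ submod_closed W, (forall m, m \in W -> m \in C -> m = 0) &
      forall W' : {pred M}, submod_closed W' -> {subset W <= W'} ->
        (forall m, m \in W' -> m \in C -> m = 0) -> {subset W' <= W}].
Proof.
pose P (X : set M) := (forall a u v, X u -> X v -> X (a *: u + v)) /\
  (forall m, X m -> m \in C -> m = 0).
have [F FP Ftot|X [[XP XC] Xmax]] := @Zorn_bigcup M P.
  split=> [a u v [Y FY Yu] [Z FZ Zv] | m [Y FY Ym]]; last by have [_] := FP Y FY; apply.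
  by have [YZ | ZY] := Ftot Y Z FY FZ;
    [exists Z => //; have [+ _] := FP Z FZ; apply => //; apply: YZ
    |exists Y => //; have [+ _] := FP Y FY; apply => //; apply: ZY].
have maxX (Y : set M) : P Y -> (forall m, X m -> Y m) -> forall m, Y m -> X m.
  move=> PY XY m Ym; apply: contrapT => NXm; apply: (Xmax Y) => //.
  by split=> // YX; apply/NXm/YX.
(* The empty set also satisfies [P], since Zorn's lemma needs a bound for the
   empty chain; a maximal [X] is nonempty because the zero module competes. *)
have X0 : X 0.
  apply: contrapT => NX0; apply: (NX0).
  have P0 : P [set 0]%classic.
    by split=> [a u v -> ->|m -> //]; rewrite /= scaler0 addr0.
  apply: (maxX _ P0) => // m Xm; case: NX0.
  by have := XP (-1) m m Xm Xm; rewrite scaleN1r addNr.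
exists (fun m => `[< X m >]); split.
- split; first by apply/asboolP.
  by move=> a u v /asboolP Xu /asboolP Xv; apply/asboolP/XP.
- by move=> m /asboolP; apply: XC.
- move=> W' [W'0 W'P] XW' W'C m mW'; apply/asboolP.
  apply: (maxX (fun m => m \in W')) => // z Xz.
  by apply: XW'; apply/asboolP.
Qed.

(** Both modules are the quotient of the ring by the common annihilator; arguing
    with generators and annihilators avoids comparing different constructions of
    that quotient. *)
Lemma cyclic_isomorphic (N : lmodType R) (v : M) (w : N) :
  (forall m, exists r : R, m = r *: v) -> (forall z, exists r : R, z = r *: w) ->
  (forall r : R, r *: v = 0 <-> r *: w = 0) -> isomorphic M N.
Proof.
move=> genv genw ann.
have /choice[c cE] := genv; have /choice[c' c'E] := genw.
have annB a b : a *: v = b *: v <-> a *: w = b *: w.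
  split=> /eqP; rewrite -subr_eq0 -scalerBl => /eqP/ann/eqP.
    by rewrite scalerBl subr_eq0 => /eqP.
  by rewrite scalerBl subr_eq0 => /eqP.
pose g m := c m *: w.
have gl : linear g.
  move=> a m m'; rewrite /g scalerA -scalerDl; apply/annB.
  by rewrite -cE scalerDl -scalerA -!cE.
have gL := GRing.isLinear.Build R M N *:%R g gl.
pose G : {linear M -> N} := HB.pack g gL.
exists G; exists (fun z => c' z *: v) => [m | z] /=.
  by rewrite [RHS]cE; apply/annB; rewrite -c'E.
by rewrite [RHS]c'E /g; apply/annB; rewrite -cE.
Qed.

Lemma isomorphic_sym (N : lmodType R) : isomorphic M N -> isomorphic N M.
Proof.
move=> [f [g fK gK]].
have gl : linear g by exact: can2_linear fK gK.
have gL := GRing.isLinear.Build R N M *:%R g gl.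
pose G : {linear N -> M} := HB.pack g gL.
by exists G, f.
Qed.

End Submodules.

(** * Generalized weight vectors *)

Section Weights.
Variables (K : fieldType) (charK : [pchar K] =i pred0) (M : lmodType (I1 K)).
Implicit Types (D W : {pred M}) (m z : M) (mu : K) (p q : {poly K}) (j : int).

(** The exponent may be 0, which only adds the zero vector: this spares the side
    condition of [gen_weight_space]. *)
Definition weight mu m := exists k, evalH (('X - mu%:P) ^+ k) *: m = 0.
(** Being a sum of weight vectors of weights other than [mu], in a form that needs
    no decomposition: it is visibly stable under sums, and Bezout's identity
    separates such vectors from those of weight [mu]. *)
Definition away mu m := exists2 q, ~~ root q mu & evalH q *: m = 0.

Lemma evalH_scaleM p q m : evalH (p * q) *: m = evalH p *: (evalH q *: m).
Proof. by rewrite evalHM scalerA. Qed.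

Lemma evalH_scaleC p q m : evalH p *: (evalH q *: m) = evalH q *: (evalH p *: m).
Proof. by rewrite -!evalH_scaleM mulrC. Qed.

(** If [a p + b q = 1] then [z = a(H) p(H) z + b(H) q(H) z], and the second term
    vanishes. This is the one argument behind the independence of weight spaces and
    the inversion of [q(H)] on a weight space of weight not a root of [q]. *)
Lemma submod_coprime D p q z : submod_closed D -> coprimep p q ->
  evalH q *: z = 0 -> evalH p *: z \in D -> z \in D.
Proof.
move=> SD /Bezout_eq1_coprimepP[[a b] /= ab1] qz pz.
rewrite -[z]scale1r -(evalH1 K) -ab1 evalHD scalerDl.
by rewrite !evalH_scaleM qz scaler0 addr0 submodZ.
Qed.

Lemma weightP mu m : gen_weight_space mu m <-> weight mu m.
Proof.
split=> [[k _ km]|[k km]]; first by exists k; rewrite evalHXsubC.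
by exists k.+1 => //; rewrite exprS -scalerA -evalHXsubC km scaler0.
Qed.

Lemma weight0 mu : weight mu 0. Proof. by exists 0%N; rewrite scaler0. Qed.

Lemma weightD mu m m' : weight mu m -> weight mu m' -> weight mu (m + m').
Proof.
move=> [k km] [k' km']; exists (k + k')%N.
by rewrite scalerDr exprD evalH_scaleM evalH_scaleC km evalH_scaleM km' !scaler0 addr0.
Qed.

Lemma weight_sum mu I (s : seq I) (P : pred I) (g : I -> M) :
  (forall i, P i -> weight mu (g i)) -> weight mu (\sum_(i <- s | P i) g i).
Proof.
by move=> gP; apply: (big_ind (weight mu)) => //;
  [exact: weight0 | exact: weightD].
Qed.

Lemma weight_evalH mu p m : weight mu m -> weight mu (evalH p *: m).
Proof. by move=> [k km]; exists k; rewrite evalH_scaleC km scaler0. Qed.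

Lemma weight_shift mu j m : weight mu m -> weight (mu + j%:~R) (shift K j *: m).
Proof.
move=> [k km]; exists k; rewrite evalHXsubC scalerA H_sub_shift // -scalerA.
by rewrite -evalHXsubC km scaler0.
Qed.

Lemma away0 mu : away mu 0.
Proof. by exists 1; rewrite ?scaler0 // root1. Qed.

Lemma awayD mu m m' : away mu m -> away mu m' -> away mu (m + m').
Proof.
move=> [q qmu qm] [q' qmu' qm']; exists (q * q'); first by rewrite rootM negb_or qmu.
by rewrite scalerDr evalH_scaleM evalH_scaleC qm evalH_scaleM qm' !scaler0 addr0.
Qed.

Lemma away_sum mu I (s : seq I) (P : pred I) (g : I -> M) :
  (forall i, P i -> away mu (g i)) -> away mu (\sum_(i <- s | P i) g i).
Proof.
by move=> gP; apply: (big_ind (away mu)) => //;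
  [exact: away0 | exact: awayD].
Qed.

Lemma weight_away mu nu m : mu != nu -> weight nu m -> away mu m.
Proof.
move=> munu [k km]; exists (('X - nu%:P) ^+ k) => //.
by rewrite rootE !hornerE expf_neq0 // subr_eq0.
Qed.

(** Submodules are graded by weights: Bezout's identity yields a polynomial in [H]
    that projects [z + z'] onto [z]. *)
Lemma component D mu z z' : submod_closed D -> weight mu z -> away mu z' ->
  z + z' \in D -> z \in D.
Proof.
move=> SD [k kz] [q qmu qz'] zz'.
apply: (submod_coprime SD (p := q) _ kz).
  by apply: coprimep_expr; rewrite coprimep_XsubC.
by move: (submodZ (evalH q) SD zz'); rewrite scalerDr qz' addr0.
Qed.

Lemma weight_away_eq0 mu z : weight mu z -> away mu z -> z = 0.
Proof.
move=> wz az; have : z \in pred1 (0 : M); last by rewrite inE => /eqP.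
apply: (component (submod_pred1_0 M) wz (z' := - z)).
  by case: az => q qmu qz; exists q; rewrite // scalerN qz oppr0.
by rewrite subrr inE.
Qed.

(** Write [p = q (X - l)^k] with [q(l)] nonzero. As [q(H)] is invertible on [v], the
    vector [(H - l)^k v] lies in [D]; either [k >= n], or a further power of [H - l]
    brings it to [(H - l)^(n-1) v]. *)
Lemma evalH_cyclic D l n v p : submod_closed D ->
  evalH (('X - l%:P) ^+ n) *: v = 0 -> evalH p *: v \in D ->
  ('X - l%:P) ^+ n %| p \/ evalH (('X - l%:P) ^+ n.-1) *: v \in D.
Proof.
move=> SD nv pv.
have [k [q ql pE]] := multiplicity_XsubC p l.
have [p0|p0] := eqVneq p 0; first by left; rewrite p0 dvdp0.
have [nk|kn] := leqP n k.
  by left; rewrite pE dvdp_mull // dvdp_exp2l.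
right; have kn1 : (k <= n.-1)%N by rewrite -ltnS (ltn_predK kn).
rewrite -(subnK kn1) exprD evalH_scaleM submodZ //.
apply: (submod_coprime SD (p := q) (q := ('X - l%:P) ^+ n)).
- by apply: coprimep_expr; rewrite coprimep_XsubC; move: ql; rewrite p0.
- by rewrite evalH_scaleC nv scaler0.
- by rewrite -evalH_scaleM -pE.
Qed.

End Weights.

(** * Modules annihilated by F *)

Section LaurentModules.
Variables (K : fieldType) (charK : [pchar K] =i pred0) (M : lmodType (I1 K)).
Hypothesis FM : forall (f : I1 K) (m : M), f \in @I1F K -> f *: m = 0.
Implicit Types (D W : {pred M}) (m z : M) (mu : K) (p q : {poly K}) (j : int).

Lemma int_shift_act j m : I1int K *: (shift K j *: m) = shift K (j + 1) *: m.
Proof.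
apply/esym/eqP; rewrite -subr_eq0 scalerA -scalerBl; apply/eqP/FM.
exact: int_shift.
Qed.

Lemma shiftK D j m : submod_closed D -> shift K j *: m \in D -> m \in D.
Proof.
move=> SD; case: j => k.
  elim: k => [|k IHk]; first by rewrite /= scale1r.
  move/(submodZ (I1d K) SD); rewrite scalerA d_shift // => kD.
  by apply: IHk; rewrite -[Posz k](_ : Posz k.+1 - 1 = k) //; lia.
elim: k => [|k IHk] /(submodZ (I1int K) SD); rewrite int_shift_act.
  by rewrite (_ : Negz 0 + 1 = 0) /= ?scale1r //; lia.
by rewrite (_ : Negz k.+1 + 1 = Negz k) //; lia.
Qed.

Lemma normal_form_act (u : I1 K) : exists (s : seq int) (P : int -> {poly K}),
  uniq s /\ forall m, u *: m = \sum_(j <- s) shift K j *: (evalH (P j) *: m).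
Proof.
have [s [P [f [us fF ->]]]] := normal_form charK u.
exists s, P; split=> // m; rewrite scalerDl FM // add0r scaler_suml.
by apply: eq_bigr => j _; rewrite scalerA.
Qed.

Lemma addr_int_neq mu i j : i != j -> mu + i%:~R != mu + j%:~R.
Proof. by rewrite (inj_eq (addrI mu)) (inj_eq (@intr_inj_char0 _ charK)). Qed.

(** Only the term of index 0 of the normal form of [u] preserves weights, so [u] acts
    on weight vectors as a polynomial in [H], up to terms of other weights. *)
Lemma component_act (u : I1 K) :
  exists p, forall mu m, weight mu m -> away mu (u *: m - evalH p *: m).
Proof.
have [s [P [us uE]]] := normal_form_act u.
pose p := \sum_(j <- s | j == 0) P j.
exists p => mu m wm; rewrite uE (bigID (eq_op^~ 0)) /=.
have -> : evalH p *: m = \sum_(j <- s | j == 0) shift K j *: (evalH (P j) *: m).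
  rewrite [evalH _]rmorph_sum scaler_suml; apply: eq_bigr => j /eqP ->.
  by rewrite /= scale1r.
rewrite [X in X - _]addrC addrK; apply: away_sum => j j0.
apply: weight_away; last exact/weight_shift/weight_evalH/wm.
by rewrite -{1}[mu]addr0 -[0]/(0%:~R) addr_int_neq // eq_sym.
Qed.

(** Relations between weight vectors of equal weight that use arbitrary scalars can be
    replaced by relations that use polynomials in [H]: this reduces questions on
    modules to questions on one weight space with the operator [H]. *)
Lemma submod_component D mu z m (u : I1 K) : submod_closed D ->
  weight mu z -> weight mu m -> z + u *: m \in D ->
  exists p, z + evalH p *: m \in D.
Proof.
move=> SD wz wm zm; have [p pP] := component_act u; exists p.
apply: (component SD (mu := mu) (z' := u *: m - evalH p *: m));
  last by rewrite -addrA [evalH p *: m + _]addrC subrK.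
  by apply: weightD => //; apply: weight_evalH.
exact: pP.
Qed.

Lemma act_away mu nu m (u : I1 K) : nu - mu \notin @Zpred K -> weight mu m ->
  away nu (u *: m).
Proof.
move=> numu wm; have [s [P [_ ->]]] := normal_form_act u.
apply: away_sum => j _; apply: weight_away; last exact/weight_shift/weight_evalH/wm.
apply: contraNneq numu => ->; apply/asboolP; exists j.
by rewrite addrC addKr.
Qed.

(** The image of [u] modulo [W] generates a simple module. Indeed [H] acts on this
    image by the scalar [mu], so [r u] is modulo [W] a sum of multiples of shifts
    of [u]; these have distinct weights, so a submodule that contains [r u] contains
    each of them, and shifting back recovers [u] from a nonzero one. *)
Lemma simple_step W D mu u (r : I1 K) : submod_closed W -> submod_closed D ->
  {subset W <= D} -> weight mu u -> evalH ('X - mu%:P) *: u \in W ->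
  r *: u \notin W -> r *: u \in D -> u \in D.
Proof.
move=> SW SD WD wu uW; have [s [P [us rE]]] := normal_form_act r.
move=> ruW ruD.
have [j js jW] : exists2 j, j \in s & shift K j *: (evalH (P j) *: u) \notin W.
  apply: contrapT => N; case/negP: ruW; rewrite rE big_seq.
  apply: (submod_sum _ SW) => j js; apply: contrapT => /negP jW.
  by apply: N; exists j.
have cE : evalH (P j) *: u - (P j).[mu]%:A *: u \in W.
  have /factor_theorem[q qE] : root (P j - (P j).[mu]%:P) mu.
    by rewrite rootE !hornerE subrr.
  rewrite -scalerBl -evalHC -evalHB.
  by rewrite qE evalH_scaleM submodZ.
have c0 : (P j).[mu] != 0.
  apply: contraNneq jW => c0; apply: submodZ => //.
  by move: cE; rewrite c0 scale0r scale0r subr0.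
have : shift K j *: (evalH (P j) *: u) \in D.
  move: ruD; rewrite rE (bigD1_seq j) //=; apply: (component SD (mu := mu + j%:~R)).
    exact/weight_shift/weight_evalH.
  apply: away_sum => i ij; apply: weight_away (addr_int_neq mu _) _.
    by rewrite eq_sym; apply: ij.
  exact/weight_shift/weight_evalH.
move/(shiftK SD) => jD.
have : (P j).[mu]%:A *: u \in D.
  rewrite -[_ *: u](subKr (evalH (P j) *: u)); apply: submodB => //.
  exact: WD.
move/(submodZ ((P j).[mu]^-1)%:A SD).
by rewrite scalerA -scalerAl mul1r scalerA mulVf // !scale1r.
Qed.

Lemma gen_weight_span : gen_weight M -> forall m, exists (s : seq K) (f : K -> M),
  (forall l, weight l (f l)) /\ m = \sum_(l <- s) f l.
Proof.
move=> [+ _] m => /(_ m)[s [f [_ fP ->]]]; exists s, f; split=> // l.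
by apply/weightP.
Qed.

Lemma weight_generators D : gen_weight M -> submod_closed D ->
  ~ (forall m, m \in D) -> exists mu u, weight mu u /\ u \notin D.
Proof.
move=> gM SD ND; apply: contrapT => N; apply: ND => m.
have [s [f [fw ->]]] := gen_weight_span gM m.
apply: (submod_sum _ SD) => l _; apply: contrapT => /negP lD; apply: N.
by exists l, (f l).
Qed.

(** Apply [H - mu] to [u] as long as the result stays outside [D]. *)
Lemma last_outside D mu u : submod_closed D -> weight mu u -> u \notin D ->
  exists u', [/\ weight mu u', u' \notin D & evalH ('X - mu%:P) *: u' \in D].
Proof.
move=> SD [k]; elim: k u => [|k IHk] u.
  by rewrite expr0 evalH1 scale1r => -> /negP[]; apply: submod0.
rewrite exprSr evalH_scaleM => ku uD.
have [uD'|uD'] := boolP (evalH ('X - mu%:P) *: u \in D); last exact: IHk uD'.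
by exists u; split=> //; exists k.+1; rewrite exprSr evalH_scaleM.
Qed.

(** A vector of maximal nilpotency order generates a direct summand, as for the longest
    Jordan block of a nilpotent operator. Take [W] maximal among the submodules that
    meet the module generated by [v] in zero, and [D] the sum of both. If [D] is proper,
    then a weight vector [u] outside [D] can be chosen with [(H - mu) u] in [D], and be
    corrected by an element of the module of [v] so that [(H - mu) u] lies in [W]. By
    [simple_step], adjoining [u] to [W] contradicts the maximality of [W]. *)
Lemma jordan_cyclic l n v : indecomposable M -> gen_weight M ->
  evalH (('X - l%:P) ^+ n) *: v = 0 -> evalH (('X - l%:P) ^+ n.-1) *: v != 0 ->
  (forall z, weight l z -> evalH (('X - l%:P) ^+ n) *: z = 0) ->
  forall m, exists r : I1 K, m = r *: v.
Proof.
move=> [_ indM] gM nv nv1 nl.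
have n0 : (0 < n)%N by case: n nv nv1 {nl} => // ->; rewrite eqxx.
have wv : weight l v by exists n.
have SZ := submod_pred1_0 M; set Z := (pred1 (0 : M) : {pred M}) in SZ.
pose C := adjoin Z v; have SC : submod_closed C := adjoin_closed v SZ.
have vC : v \in C := adjoin_gen v SZ.
have [W [SW WC Wmax]] := max_disjoint C.
pose D := adjoin W v; have SD : submod_closed D := adjoin_closed v SW.
have WD : {subset W <= D} := @sub_adjoin _ _ W v.
have DE m : (exists a b, [/\ a \in W, b \in C & m = a + b]) <-> m \in D.
  split=> [[a [b [aW bC ->]]]|/asboolP[r rW]].
    have /adjoin0P[r ->] := bC.
    by apply/asboolP; exists r; rewrite addrK.
  by exists (m - r *: v), (r *: v); rewrite subrK; split=> //; apply: submodZ.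
have [Dall|/(weight_generators gM SD)[mu0 [u0 [wu0 u0D]]]] :=
  pselect (forall m, m \in D).
  have [W0|C0] := indM W C SW SC (fun m => (DE m).2 (Dall m)) WC.
    move=> m; have [a [b [aW bC ->]]] := (DE m).2 (Dall m).
    move: aW; rewrite W0 inE => /eqP ->; rewrite add0r.
    exact/adjoin0P.
  by move: vC nv1; rewrite C0 inE => /eqP ->; rewrite scaler0 eqxx.
suff [mu [u [wu uD uW]]] :
    exists mu u, [/\ weight mu u, u \notin D & evalH ('X - mu%:P) *: u \in W].
  have sW' : {subset adjoin W u <= W}.
    apply: Wmax (adjoin_closed u SW) (@sub_adjoin _ _ W u) _.
    move=> m /asboolP[r rW] mC; apply: WC => //.
    have mD : m \in D by apply/DE; exists 0, m; rewrite add0r submod0.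
    have ruD : r *: u \in D.
      by rewrite -[r *: u](subKr m); apply: submodB => //; apply: WD.
    rewrite -[m](subrK (r *: u)); apply: submodD => //; apply: contraNT uD => ruW.
    exact: simple_step SW SD WD wu uW ruW ruD.
  by case/negP: uD; apply/WD/sW'/adjoin_gen.
(* If [mu0] is not congruent to [l], then no weight of the module of [v] is equal
   to [mu0], and the component of weight [mu0] already lies in [W]. *)
have [muZ|muZ] := boolP (mu0 - l \in @Zpred K); last first.
  have [u [wu uD uND]] := last_outside SD wu0 u0D.
  exists mu0, u; split=> //; have /asboolP[r rW] := uND.
  apply: (component SW (mu := mu0) (z' := - (r *: v)) (weight_evalH _ wu)) => //.
  by rewrite -scaleNr; apply: act_away muZ wv.
have /asboolP[j jE] := muZ.
have u1D : shift K (- j) *: u0 \notin D.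
  by apply: contraNN u0D; apply: shiftK.
have wu1 : weight l (shift K (- j) *: u0).
  have -> : l = mu0 + (- j)%:~R by rewrite mulrNz -jE opprB addrC subrK.
  exact: weight_shift.
have [u [wu uD uND]] := last_outside SD wu1 u1D.
have /asboolP[r] := uND; rewrite -scaleNr => rW.
have [p pW] := submod_component SW (weight_evalH _ wu) wv rW.
(* The order of [v] is maximal, so [(H - l)^(n-1)] kills [(H - l) u]; hence it maps
   [p(H) v] into [W], and [p] has to vanish at [l]. *)
have lastE : evalH (('X - l%:P) ^+ n.-1) *: (evalH p *: v) \in W.
  move: (submodZ (evalH (('X - l%:P) ^+ n.-1)) SW pW); rewrite scalerDr.
  by rewrite -[X in X + _]evalH_scaleM -exprSr (ltn_predK n0) (nl u wu) add0r.
have [q qE] : exists q, p = q * ('X - l%:P).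
  apply/factor_theorem; rewrite rootE.
  have : evalH (('X - l%:P) ^+ n.-1 * p) *: v \in Z.
    by rewrite inE; apply/eqP/WC; rewrite ?evalH_scaleM // !submodZ.
  case/(evalH_cyclic SZ nv) => [|]; last by rewrite inE (negPf nv1).
  rewrite -{1}(ltn_predK n0) exprSr dvdp_mul2l ?dvdp_XsubCl //.
  by rewrite expf_neq0 // polyXsubC_eq0.
exists l, (u + evalH q *: v); split.
- by apply: weightD => //; apply: weight_evalH.
- apply: contra uD => uqD; rewrite -[u](addrK (evalH q *: v)).
  by apply: submodB => //; apply/submodZ/adjoin_gen.
- by rewrite scalerDr -evalH_scaleM mulrC -qE.
Qed.

(** [H - mu] maps the vectors of weight [mu] of each term of a composition series into
    the preceding term [N i]. Otherwise the simplicity of the factor puts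
    [z + p(H) (H - mu) z] into [N i] for some [p]; as [H - mu] is nilpotent on [z],
    the operator [1 + p(H) (H - mu)] is invertible there, and [z] lies in [N i]. *)
Lemma finite_length_bound : finite_length M ->
  exists n, forall mu z, weight mu z -> evalH (('X - mu%:P) ^+ n) *: z = 0.
Proof.
move=> [n [N [N0 Nn SN Nmax]]]; exists n => mu.
suff bound i : (i <= n)%N -> forall z, z \in N i -> weight mu z ->
    evalH (('X - mu%:P) ^+ i) *: z = 0.
  by move=> z; apply: bound; rewrite // Nn.
elim: i => [|i IHi] lt_in z.
  by rewrite N0 inE => /eqP -> _; rewrite scaler0.
move=> zN wz; rewrite exprSr evalH_scaleM.
apply: IHi; [exact: ltnW | | exact: weight_evalH].
have SNi := SN i (ltnW lt_in); have SNi1 := SN i.+1 lt_in.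
have [Nii1 _ /(_ (adjoin (N i) (evalH ('X - mu%:P) *: z)))] := Nmax i lt_in.
case=> [||m /asboolP[r rN]|LN|LN].
- exact: adjoin_closed.
- exact: sub_adjoin.
- rewrite -[m](subrK (r *: (evalH ('X - mu%:P) *: z))).
  by apply: submodD => //; [apply: Nii1 | do 2!apply: submodZ => //].
- by rewrite -LN adjoin_gen.
move: zN; rewrite -LN => /asboolP[r]; rewrite -scaleNr => rN.
have [p pN] := submod_component SNi wz (weight_evalH _ wz) rN.
apply: submodZ => //; have [k kz] := wz.
apply: (submod_coprime SNi (p := 1 + p * ('X - mu%:P)) _ kz).
  apply: coprimep_expr; rewrite coprimep_XsubC rootE !hornerE subrr mulr0 addr0.
  exact: oner_neq0.
by rewrite evalHD evalH1 scalerDl scale1r evalH_scaleM.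
Qed.

End LaurentModules.

(** * Splitting off the part on which the derivation is locally nilpotent *)

Section Splitting.
Variables (K : fieldType) (charK : [pchar K] =i pred0) (M : lmodType (I1 K)).
Implicit Types (m z : M) (mu : K).
Local Notation d := (I1d K).
Local Notation i1 := (I1int K).
Local Notation e := (I1e K 0 0).

Lemma e00_decomp m : m = e *: m + i1 *: (d *: m).
Proof. by rewrite e00E scalerBl scale1r scalerA subrK. Qed.

(** [e H = e] forces [e (H - mu)^k = (1 - mu)^k e]. *)
Lemma weight_e00 mu z : mu != 1 -> weight mu z -> e *: z = 0.
Proof.
move=> mu1 [k kz].
have eH1 : e * (I1H K - mu%:A) = (1 - mu) *: e.
  by rewrite mulrBr e00_H // -scalerAr mulr1 scalerBl scale1r.
have eH : e * (I1H K - mu%:A) ^+ k = ((1 - mu) ^+ k) *: e.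
  elim: k {kz} => [|k IHk]; first by rewrite expr0 mulr1 scale1r.
  by rewrite exprSr mulrA IHk -scalerAl eH1 scalerA -exprSr.
have k0 : (1 - mu) ^+ k != 0 by rewrite expf_neq0 // subr_eq0 eq_sym.
rewrite -[e]scale1r -(mulVf k0) -scalerA -eH -[_ *: (_ * _)]mul1r scalerAl.
by rewrite -scalerA -scalerA -evalHXsubC kz !scaler0.
Qed.

Lemma weight_d mu j z : weight mu z -> weight (mu - j%:R) (d ^+ j *: z).
Proof.
move/(weight_shift charK (- j%:Z)); rewrite mulrNz -pmulrn.
by case: j.
Qed.

(** Each application of [d] lowers the weights by 1, so each of the finitely many weights
    of [m] passes through the value 1 at most once. *)
Lemma e00_d_finite : gen_weight M ->
  forall m, exists n, forall j, (n <= j)%N -> e *: (d ^+ j *: m) = 0.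
Proof.
move=> gM m; have [s [f [fw ->]]] := gen_weight_span gM m.
elim: s => [|l s [n IHn]].
  by exists 0%N => j _; rewrite big_nil !scaler0.
have [n' nP] : exists n', forall j, (n' <= j)%N -> e *: (d ^+ j *: f l) = 0.
  have [[i il]|Ni] := pselect (exists i : nat, l = i.+1%:R).
    exists i.+1 => j ij; apply: weight_e00 (weight_d j (fw l)).
    rewrite il -(subnKC ij) natrD opprD addrA subrr add0r -subr_eq0 -opprD oppr_eq0.
    by rewrite natr1 natS_neq0.
  exists 0%N => j _; apply: weight_e00 (weight_d j (fw l)).
  apply/eqP => lj; apply: Ni; exists j.
  by apply/eqP; rewrite -natr1 addrC -subr_eq lj.
exists (maxn n n') => j; rewrite geq_max => /andP[nj n'j].
by rewrite big_cons !scalerDr nP // IHn // addr0.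
Qed.

Definition torsion : {pred M} := fun m => `[< exists n, d ^+ n *: m = 0 >].
(** The largest submodule annihilated by [e], equivalently by F. Quantifying over all
    [u] makes it a submodule by construction. *)
Definition flat : {pred M} := fun m => `[< forall u : I1 K, e *: (u *: m) = 0 >].

Lemma flat_closed : submod_closed flat.
Proof.
split; first by apply/asboolP => u; rewrite !scaler0.
move=> a m m' /asboolP mP /asboolP m'P; apply/asboolP => u.
by rewrite !scalerDr (scalerA u) mP m'P addr0.
Qed.

Lemma F_act m (f : I1 K) : (forall j, e *: (d ^+ j *: m) = 0) ->
  f \in @I1F K -> f *: m = 0.
Proof.
move=> ed /asboolP[n [c ->]]; rewrite scaler_suml big1 // => i _.
rewrite scaler_suml big1 // => j _.
by rewrite e_factor -[X in X *: m]mul1r -scalerAr scalerAl -!scalerA ed !scaler0.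
Qed.

Lemma flat_F m (f : I1 K) : m \in flat -> f \in @I1F K -> f *: m = 0.
Proof. by move=> /asboolP mP; apply: F_act => j; apply: mP. Qed.

Lemma flat_d m : (forall j, e *: (d ^+ j *: m) = 0) -> m \in flat.
Proof.
move=> ed; apply/asboolP => u; rewrite scalerA; apply: F_act => //.
by apply: F_right_ideal => //; apply: Fe.
Qed.

Lemma torsion_closed : submod_closed torsion.
Proof.
have dD n m (k : nat) : d ^+ n *: m = 0 -> d ^+ (k + n) *: m = 0.
  by move=> nm; rewrite exprD -scalerA nm scaler0.
have TD m m' : m \in torsion -> m' \in torsion -> m + m' \in torsion.
  move=> /asboolP[n nm] /asboolP[n' nm']; apply/asboolP; exists (n + n')%N.
  by rewrite scalerDr [X in d ^+ X *: m]addnC !dD // addr0.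
have T0 : 0 \in torsion by apply/asboolP; exists 0%N; rewrite scaler0.
pose S : {pred I1 K} := fun r => `[< forall m, m \in torsion -> r *: m \in torsion >].
have SM : {in S &, forall u v, u * v \in S}.
  move=> u v /asboolP uS /asboolP vS; apply/asboolP => m mT.
  by rewrite -scalerA uS ?vS.
have SZ (a : K) u : u \in S -> a *: u \in S.
  move=> /asboolP uS; apply/asboolP => m /uS/asboolP[n nm]; apply/asboolP.
  by exists n; rewrite scalerA -scalerAr -[_ * _]mul1r scalerAl -!scalerA nm scaler0.
have SD : {in S &, forall u v, u + v \in S}.
  move=> u v /asboolP uS /asboolP vS; apply/asboolP => m mT.
  by rewrite scalerDl TD ?uS ?vS.
have Si : i1 \in S.
  apply/asboolP => m /asboolP[n nm]; apply/asboolP; exists n.+1.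
  by rewrite exprSr -scalerA (scalerA d) d_int // scale1r.
have Sd : d \in S.
  apply/asboolP => m /asboolP[n nm]; apply/asboolP; exists n.
  by rewrite scalerA -exprSr exprS -scalerA nm scaler0.
have S1 : 1 \in S by apply/asboolP => m; rewrite scale1r.
have dH n : d ^+ n * I1H K = (I1H K + n%:R%:A) * d ^+ n.
  elim: n => [|n IHn]; first by rewrite expr0 mulr1 mul1r scale0r addr0.
  have dHn : d * (I1H K + n%:R%:A) = (I1H K + n.+1%:R%:A) * d.
    rewrite mulrDr d_H -scalerAr mulr1 !mulrDl mul1r -scalerAl mul1r -addrA.
    by rewrite -natr1 scalerDl scale1r [d + _]addrC.
  by rewrite exprS -mulrA IHn !mulrA dHn.
have SH : I1H K \in S.
  apply/asboolP => m /asboolP[n nm]; apply/asboolP; exists n.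
  by rewrite scalerA dH -scalerA nm scaler0.
split=> // r u v uT; apply: TD.
suff /asboolP : r \in S by apply.
apply: I1_ind => //; first by split=> // a y z yS zS; apply: SD => //; apply: SZ.
by rewrite xE // SM.
Qed.

(** On a submodule where [e] vanishes, integration inverts [d], so [d] is injective. *)
Lemma torsion_flat_eq0 m : m \in torsion -> m \in flat -> m = 0.
Proof.
case/asboolP=> n; elim: n m => [|n IHn] m; first by rewrite expr0 scale1r.
rewrite exprSr -scalerA => dm mB.
have d0 : d *: m = 0 by apply: (IHn _ dm); apply: submodZ => //; exact: flat_closed.
move/asboolP: mB => /(_ 1); rewrite scale1r => em.
by rewrite [m]e00_decomp em d0 scaler0 addr0.
Qed.

(** The summand in [flat] is obtained by differentiating [m] often enough to pass all
    the weights at which [e] acts nontrivially, and then integrating back equally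
    often; the difference is killed by that power of [d]. *)
Lemma torsion_flat_split : gen_weight M ->
  forall m, exists a b, [/\ a \in torsion, b \in flat & m = a + b].
Proof.
move=> gM m; have [n nP] := e00_d_finite gM m.
have di k : d ^+ k * i1 ^+ k = 1.
  elim: k => [|k IHk]; first by rewrite !expr0 mulr1.
  by rewrite exprSr exprS mulrA -[_ * d * i1]mulrA d_int // mulr1.
exists (m - i1 ^+ n *: (d ^+ n *: m)), (i1 ^+ n *: (d ^+ n *: m)).
rewrite subrK; split=> //.
  by apply/asboolP; exists n; rewrite scalerBr !scalerA mulrA di mul1r subrr.
apply: flat_d => j; have [nj|jn] := leqP n j.
  by rewrite -(subnK nj) exprD !scalerA -!mulrA (mulrA (d ^+ n)) di mul1r -exprD
    -scalerA subnK // nP.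
rewrite -(subnKC (ltnW jn)) exprD (scalerA (d ^+ j)) mulrA di mul1r.
case: (n - j)%N (subn_gt0 j n) => [|k _]; first by rewrite jn.
by rewrite scalerA exprS mulrA e00_int // mul0r scale0r.
Qed.

End Splitting.

(** * Criteria for generalized weight and indecomposable modules *)

Section Criteria.
Variables (K : fieldType) (charK : [pchar K] =i pred0) (M : lmodType (I1 K)).

(** The independence of the weight spaces is automatic by Bezout's identity, so it is
    enough to decompose every vector, possibly with repeated weights. *)
Lemma gen_weight_intro (I : Type) :
  (forall m : M, exists (s : seq I) (w : I -> K) (g : I -> M),
     (forall i, weight (w i) (g i)) /\ m = \sum_(i <- s) g i) ->
  gen_weight M.
Proof.
move=> gen; split=> [m|s f us fw f0 l ls].
  have [s [w [g [gw ->]]]] := gen m.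
  exists (undup (map w s)), (fun l => \sum_(i <- s | w i == l) g i).
  split; [exact: undup_uniq | | exact: big_regroup].
  by move=> l; apply/weightP/weight_sum => i /eqP <-.
move: f0; rewrite (bigD1_seq l) //= => f0.
have /weightP wl := fw l.
apply: (weight_away_eq0 wl).
rewrite -[f l](addrK (\sum_(i <- s | i != l) f i)) f0 sub0r -sumrN.
apply: away_sum => i il; apply: (@weight_away _ _ _ i); first by rewrite eq_sym.
by have /weightP[k ki] := fw i; exists k; rewrite scalerN ki oppr0.
Qed.

End Criteria.

Section Essential.
Variables (R : pzRingType) (M : lmodType R).

(** Two nonzero submodules both contain [v], so they cannot be independent. *)
Lemma indecomposable_essential (v : M) : v != 0 ->
  (forall D : {pred M}, submod_closed D ->
     forall m, m \in D -> m != 0 -> v \in D) ->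
  indecomposable M.
Proof.
move=> v0 vP; split=> [|A B SA SB _ AB0]; first by exists v.
have zero (D : {pred M}) : submod_closed D -> v \notin D -> D =i pred1 0.
  move=> SD vD m; rewrite inE; apply/idP/eqP => [mD|->]; last exact: submod0.
  by apply/eqP; apply: contraNT vD; apply: vP mD.
have [vA|vA] := boolP (v \in A); last by left; apply: zero.
right; apply: zero => //; apply: contra v0 => vB; apply/eqP; exact: AB0.
Qed.

End Essential.

(** * The module of polynomials *)

Section PolynomialModule.
Variables (K : fieldType) (charK : [pchar K] =i pred0).
Local Notation d := (I1d K).
Local Notation e := (I1e K 0 0).
Local Notation P := (I1poly K).
Local Notation one := ((1 : {poly K}) : P).

Definition evalx (p : {poly K}) : I1 K := horner_alg (I1x K : I1 K) p.

Lemma I1poly_scaleE (u : I1 K) (p : P) : u *: p = endo_fun (I1val u) p.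
Proof. by []. Qed.

Lemma evalx_act (p q : {poly K}) : evalx p *: (q : P) = p * q.
Proof.
elim/poly_ind: p q => [|p c IHp] q; first by rewrite [evalx 0]rmorph0 scale0r mul0r.
have -> : evalx (p * 'X + c%:P) = evalx p * I1x K + c%:A.
  by rewrite /evalx rmorphD rmorphM /= horner_algX horner_algC.
rewrite scalerDl -scalerA IHp mulrDl mulrA; congr (_ + _).
by rewrite mul_polyC.
Qed.

Lemma poly_gen (p : P) : p = evalx p *: one.
Proof. by rewrite evalx_act mulr1. Qed.

Lemma e00_poly (p : P) : e *: p = (p`_0)%:P.
Proof.
rewrite e00E scalerBl scale1r -scalerA !I1poly_scaleE /=.
apply/polyP => -[|i]; rewrite coefB coef_int_poly coefC /=.
  by rewrite invr0 mulr0 subr0.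
by rewrite coef_deriv -[X in _ - X / _]mulr_natr mulfK ?subrr // natS_neq0.
Qed.

(** Everything to the right of [e] sees constants only, so [r e] depends only on the
    polynomial [r 1]. This makes the left ideal generated by [e] a copy of the module
    of polynomials. *)
Lemma act_e00 (r : I1 K) : r * e = evalx (r *: one) * e.
Proof.
apply: val_inj; apply: endoP => q.
transitivity (r *: (e *: (q : P))); first by [].
transitivity (evalx (r *: one) *: (e *: (q : P))); last by [].
rewrite e00_poly evalx_act mulrC mul_polyC -alg_polyC.
by rewrite !I1poly_scaleE endoZ.
Qed.

(** Differentiating lowers the degree in characteristic 0; the last nonzero derivative
    is a constant. *)
Lemma poly_simple (D : {pred P}) : submod_closed D ->
  forall p, p \in D -> p != 0 -> one \in D.
Proof.
move=> SD p; have [n] := ubnP (size (p : {poly K})).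
elim: n p => // n IHn p; rewrite ltnS => sz pD p0.
have [dp0|dp0] := eqVneq (d *: p) 0; last first.
  apply: IHn dp0; last exact: submodZ.
  exact: leq_trans (lt_size_deriv p0) sz.
have := e00_decomp p; rewrite dp0 scaler0 addr0 e00_poly => pE.
have c0 : p`_0 != 0 by apply: contraNneq p0 => c0; rewrite pE c0.
have := submodZ (evalx ((p`_0)^-1)%:P) SD pD.
by rewrite evalx_act {2}pE -polyCM mulVf.
Qed.

Lemma weight_Xn (k : nat) : evalH ('X - (k.+1%:R)%:P) *: ('X^k : P) = 0.
Proof.
have := evalHXsubC (k.+1%:R : K) 1; rewrite expr1 => ->; rewrite expr1.
rewrite scalerBl I1poly_scaleE /= -exprS derivXn /= -scaler_nat.
exact: subrr.
Qed.

Lemma gen_weight_poly : gen_weight P.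
Proof.
apply: (@gen_weight_intro _ _ nat) => p.
exists (iota 0 (size (p : {poly K}))), (fun k => k.+1%:R),
  (fun k => evalx (p`_k)%:P *: ('X^k : P)).
split=> [k|].
  exists 1%N; rewrite expr1.
  have hc : evalx (p`_k)%:P = (p`_k)%:A by rewrite /evalx horner_algC.
  have -> : evalH ('X - (k.+1%:R)%:P) *: (evalx (p`_k)%:P *: ('X^k : P)) =
     evalx (p`_k)%:P *: (evalH ('X - (k.+1%:R)%:P) *: ('X^k : P)).
    by rewrite hc !scalerA -scalerAl mul1r -scalerAr mulr1.
  by rewrite weight_Xn scaler0.
rewrite -[LHS](coefK (p : {poly K})) poly_def -(big_mkord xpredT (fun k => p`_k *: 'X^k)).
rewrite /index_iota subn0; apply: eq_bigr => k _.
by rewrite evalx_act mul_polyC.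
Qed.

Lemma indecomposable_poly : indecomposable P.
Proof.
apply: (@indecomposable_essential _ P one); first exact: oner_neq0.
exact: poly_simple.
Qed.

Lemma finite_length_poly : finite_length P.
Proof.
exists 1%N, (fun i => [pred p : P | (0 < i)%N || (p == 0)] : {pred P}).
split=> //.
  by move=> [|i] _; [exact: submod_pred1_0 | split].
move=> [|//] _; split=> [//| |L SL _ _].
  by move/(_ one isT); rewrite inE (negPf (oner_neq0 _)).
have [[p [pL p0]]|N] := pselect (exists p, p \in L /\ p != 0).
  right=> q; rewrite inE [q]poly_gen; apply: submodZ => //.
  exact: poly_simple pL p0.
left=> q; rewrite inE; apply/idP/eqP => [qL|->]; last exact: submod0.
by apply: contrapT => /eqP q0; apply: N; exists q.
Qed.

Section GeneratedByE00.
Variables (M : lmodType (I1 K)) (v : M).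
Hypothesis ev : e *: v = v.

Lemma act_e00_fixed (r : I1 K) : r *: v = evalx (r *: one) *: v.
Proof. by rewrite -{1}ev scalerA act_e00 -scalerA ev. Qed.

(** The polynomials [p] with [p(x) v] in [N] form a submodule of the simple module of
    polynomials, and 1 does not belong to it. *)
Lemma e00_fixed_simple (N : {pred M}) (r : I1 K) : submod_closed N ->
  v \notin N -> r *: v \in N -> r *: one = 0.
Proof.
move=> SN vN rN; pose D : {pred P} := fun p => evalx p *: v \in N.
have SD : submod_closed D.
  split; first by rewrite unfold_in [evalx 0]rmorph0 scale0r submod0.
  move=> a p q pD qD; rewrite unfold_in.
  have -> : a *: p + q = (a * evalx p + evalx q) *: one.
    by rewrite scalerDl -scalerA -!poly_gen.
  rewrite -act_e00_fixed scalerDl -scalerA.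
  by apply: submodD => //; apply: submodZ.
apply/eqP; apply: contraNT vN => r0.
have : one \in D.
  by apply: (poly_simple SD) r0; rewrite unfold_in -act_e00_fixed.
by rewrite unfold_in [evalx 1]rmorph1 scale1r.
Qed.

Lemma poly_isomorphic : v != 0 -> (forall m, exists r : I1 K, m = r *: v) ->
  isomorphic M P.
Proof.
move=> v0 gen; apply: (cyclic_isomorphic (v := v) (w := one)) => // [p|r].
  by exists (evalx p); apply: poly_gen.
split=> [rv|r1]; last by rewrite act_e00_fixed r1 [evalx 0]rmorph0 scale0r.
by apply: (e00_fixed_simple (submod_pred1_0 M)); rewrite inE ?rv.
Qed.

End GeneratedByE00.

End PolynomialModule.

(** * Cyclic modules annihilated by F and generated by a weight vector *)

Section CyclicLaurent.
Variables (K : fieldType) (charK : [pchar K] =i pred0) (M : lmodType (I1 K)).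
Hypothesis FM : forall (f : I1 K) (m : M), f \in @I1F K -> f *: m = 0.
Variables (n : nat) (l : K) (v : M).
Hypothesis vn : evalH (('X - l%:P) ^+ n) *: v = 0.
Hypothesis vn1 : evalH (('X - l%:P) ^+ n.-1) *: v != 0.
Hypothesis gen : forall m : M, exists r : I1 K, m = r *: v.

Let SZ := submod_pred1_0 M.
Let wv : weight l v. Proof. by exists n. Qed.

Lemma cyclic_gen_weight : gen_weight M.
Proof.
apply: (@gen_weight_intro _ _ int) => m; have [r ->] := gen m.
have [s [P [_ rE]]] := normal_form_act charK FM r.
exists s, (fun j => l + j%:~R), (fun j => shift K j *: (evalH (P j) *: v)).
by split=> // j; exact/weight_shift/weight_evalH.
Qed.

(** The module generated by [v] is uniserial, with socle generated by
    [(H - l)^(n-1) v]: a nonzero component of an element of [D] is a shift of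
    [p(H) v] for some [p], and [evalH_cyclic] applies to it. *)
Lemma cyclic_essential (D : {pred M}) : submod_closed D ->
  forall m, m \in D -> m != 0 -> evalH (('X - l%:P) ^+ n.-1) *: v \in D.
Proof.
move=> SD m mD; have [r mE] := gen m.
have [s [P [us rE]]] := normal_form_act charK FM r.
rewrite {}mE in mD *; move=> r0.
have [j js j0] : exists2 j, j \in s & shift K j *: (evalH (P j) *: v) != 0.
  apply: contrapT => N; case/eqP: r0; rewrite rE big_seq big1 // => j js.
  by apply: contrapT => /eqP j0; apply: N; exists j.
have : shift K j *: (evalH (P j) *: v) \in D.
  move: mD; rewrite rE (bigD1_seq j) //=; apply: (component SD (mu := l + j%:~R)).
    exact/weight_shift/weight_evalH.
  apply: away_sum => i ij; apply: weight_away (addr_int_neq charK l _) _.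
    by rewrite eq_sym; apply: ij.
  exact/weight_shift/weight_evalH.
move/(shiftK charK FM SD)/(evalH_cyclic SD vn) => [/dvdpP[q qE]|//].
by case/eqP: j0; rewrite qE evalH_scaleM vn !scaler0.
Qed.

Lemma cyclic_indecomposable : indecomposable M.
Proof. by apply: (indecomposable_essential vn1); apply: cyclic_essential. Qed.

Lemma cyclic_weight_bound (z : M) : weight l z -> evalH (('X - l%:P) ^+ n) *: z = 0.
Proof.
move=> wz; have [r zE] := gen z.
have zr : z + (- r) *: v \in (pred1 (0 : M) : {pred M}).
  by rewrite zE scaleNr subrr inE.
have [p] := submod_component charK FM SZ wz wv zr.
by rewrite inE addr_eq0 => /eqP ->; rewrite scalerN evalH_scaleC vn scaler0 oppr0.
Qed.

Lemma cyclic_away mu (z : M) : mu - l \notin @Zpred K -> weight mu z -> z = 0.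
Proof.
move=> mul wz; have [r zE] := gen z.
by apply: (weight_away_eq0 wz); rewrite zE; apply: act_away mul wv.
Qed.

(** The vectors [(H - l)^(n-i) v] generate the terms of a composition series;
    [simple_step] gives the simplicity of the factors, and an equality of two
    consecutive terms would make some [1 + p(H) (H - l)] vanish on a nonzero weight
    vector. *)
Lemma cyclic_finite_length : finite_length M.
Proof.
pose u i := evalH (('X - l%:P) ^+ (n - i)) *: v.
have uS i : (i < n)%N -> u i = evalH ('X - l%:P) *: u i.+1.
  by move=> lt_in; rewrite /u -evalH_scaleM -exprS -subSn.
pose Z := (pred1 (0 : M) : {pred M}).
pose N i := adjoin Z (u i).
have SN i : submod_closed (N i) by apply: adjoin_closed.
have uN i : u i \in N i by apply: adjoin_gen.
exists n, N; split=> //.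
- move=> m; rewrite inE; apply/adjoin0P/eqP => [[r ->]|->].
    by rewrite /u subn0 vn scaler0.
  by exists 0; rewrite scale0r.
- move=> m; rewrite inE; apply/adjoin0P; have [r ->] := gen m; exists r.
  by rewrite /u subnn expr0 evalH1 scale1r.
move=> i lt_in.
have NS : {subset N i <= N i.+1}.
  by move=> _ /adjoin0P[r ->]; apply: submodZ => //; rewrite uS // submodZ.
have wu k : weight l (u k) by apply: weight_evalH.
split=> // [/(_ _ (uN i.+1))/adjoin0P[r]|L SL NL LN].
  rewrite (uS i) // => ur.
  have := submod_component charK FM (u := - r) SZ (wu i.+1)
    (weight_evalH ('X - l%:P) (wu i.+1)).
  rewrite {1}ur scaleNr subrr inE eqxx => /(_ isT)[p pE].
  have : u i.+1 \in Z.
    have [k ku] := wu i.+1.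
    apply: (submod_coprime SZ (p := 1 + p * ('X - l%:P)) _ ku).
      apply: coprimep_expr; rewrite coprimep_XsubC rootE !hornerE subrr mulr0 addr0.
      exact: oner_neq0.
    by rewrite evalHD evalH1 scalerDl scale1r evalH_scaleM.
  rewrite inE /u subnS => /eqP u0; case/eqP: vn1.
  have -> : n.-1 = (i + (n - i).-1)%N by lia.
  by rewrite exprD evalH_scaleM u0 scaler0.
have [[m [mL mN]]|all] := pselect (exists m, m \in L /\ m \notin N i); last first.
  left=> m; apply/idP/idP => [mL|]; last exact: NL.
  by apply: contrapT => /negP mN; apply: all; exists m.
right=> m'; apply/idP/idP; first exact: LN.
move=> /adjoin0P[r ->]; apply: submodZ => //.
have /adjoin0P[r' mE] := LN m mL; rewrite mE in mL mN.
by apply: (simple_step charK FM (SN i) SL NL (wu i.+1)) mN mL; rewrite -uS.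
Qed.

Lemma cyclic_annihilator (r : I1 K) : r *: v = 0 <-> r \in I1FH n l.
Proof.
split=> [rv|/asboolP[f [w [fF ->]]]]; last first.
  by rewrite scalerDl FM // -scalerA -evalHXsubC vn scaler0 addr0.
have [s [P [f [us fF rE]]]] := normal_form charK r.
have Pdvd j : j \in s -> ('X - l%:P) ^+ n %| P j.
  move=> js; have : shift K j *: (evalH (P j) *: v) \in (pred1 0 : {pred M}).
    have : r *: v \in (pred1 0 : {pred M}) by rewrite rv inE.
    rewrite rE scalerDl FM // add0r scaler_suml (bigD1_seq j) //= -scalerA.
    apply: (component SZ (mu := l + j%:~R)).
      exact/weight_shift/weight_evalH.
    apply: away_sum => i ij; rewrite -scalerA.
    apply: weight_away (addr_int_neq charK l _) _.
      by rewrite eq_sym; apply: ij.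
    exact/weight_shift/weight_evalH.
  move/(shiftK charK FM SZ)/(evalH_cyclic SZ vn) => [//|].
  by rewrite inE (negPf vn1).
apply/asboolP; exists f, (\sum_(j <- s) shift K j * evalH (P j %/ ('X - l%:P) ^+ n)).
split=> //; rewrite rE; congr (_ + _); rewrite mulr_suml.
rewrite big_seq [RHS]big_seq; apply: eq_bigr => j js.
by rewrite -mulrA -evalHXsubC -evalHM divpK // Pdvd.
Qed.

End CyclicLaurent.

(** * The modules M(n, l) *)

Section StandardModule.
Variables (K : fieldType) (charK : [pchar K] =i pred0).

Lemma poly_infinite_roots (p : {poly K}) (N : nat) :
  (forall k, (N <= k)%N -> p.[k.+1%:R] = 0) -> p = 0.
Proof.
move=> pN; apply: (@roots_geq_poly_eq0 _ p
  [seq k.+1%:R | k <- iota N (size p)]); last by rewrite size_map size_iota.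
  apply/allP => _ /mapP[k + ->]; rewrite mem_iota => /andP[Nk _].
  by rewrite rootE pN.
rewrite map_inj_uniq ?iota_uniq // => i j.
by move/(intr_inj_char0 charK (x1 := i.+1%:Z) (x2 := j.+1%:Z)) => [].
Qed.

Lemma F_Xn (f : I1 K) : f \in @I1F K ->
  exists N, forall k, (N <= k)%N -> f *: ('X^k : I1poly K) = 0.
Proof.
move=> /asboolP[N [c ->]]; exists N => k Nk.
have wk : weight (k.+1%:R) ('X^k : I1poly K).
  by exists 1%N; rewrite expr1 weight_Xn.
rewrite scaler_suml big1 // => i _; rewrite scaler_suml big1 // => j _.
rewrite e_factor -[X in X *: _]mul1r -scalerAr scalerAl -!scalerA.
rewrite (weight_e00 charK _ (weight_d charK j wk)) ?scaler0 //.
have jk : (j <= k)%N := ltnW (leq_trans (ltn_ord j) Nk).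
rewrite -natrB; last exact: leqW.
rewrite subSn // -subr_eq0 -natr1 addrK -[(k - j)%N]prednK ?natS_neq0 //.
by rewrite subn_gt0 (leq_trans (ltn_ord j)).
Qed.

(** The part of index 0 of the normal form is unique. Evaluated at a large power of X,
    both sides have the same component of weight [k + 1]; as F kills large powers
    of X and the terms of nonzero index change weights, the two polynomials agree
    at [k + 1] for all large [k]. *)
Lemma symbol_unique (p : {poly K}) (f : I1 K) (s : seq int) (P : int -> {poly K}) :
  f \in @I1F K -> evalH p = f + \sum_(j <- s) shift K j * evalH (P j) ->
  p = \sum_(j <- s | j == 0) P j.
Proof.
move=> /F_Xn[N fN] pE; apply/eqP; rewrite -subr_eq0; apply/eqP.
apply: (@poly_infinite_roots _ N) => k Nk; set q := p - _.
have wk : weight (k.+1%:R) ('X^k : I1poly K).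
  by exists 1%N; rewrite expr1 weight_Xn.
have qX : evalH q *: ('X^k : I1poly K) = 0.
  apply: (weight_away_eq0 (weight_evalH q wk)).
  rewrite /q evalHB pE (bigID (eq_op^~ 0)) /=.
  rewrite [X in f + (X + _)](_ : _ = evalH (\sum_(j <- s | j == 0) P j)); last first.
    by rewrite [evalH _]rmorph_sum; apply: eq_bigr => j /eqP ->; rewrite mul1r.
  rewrite addrCA [X in X - _]addrC addrK scalerDl fN // add0r scaler_suml.
  apply: away_sum => j j0; rewrite -scalerA.
  apply: weight_away; last exact/weight_shift/weight_evalH/wk.
  by rewrite -{1}[k.+1%:R]addr0 -[0]/(0%:~R) addr_int_neq // eq_sym.
have [a aE] : exists a, q - (q.[k.+1%:R])%:P = a * ('X - (k.+1%:R)%:P).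
  by apply/factor_theorem; rewrite rootE !hornerE subrr.
have : evalH (q - (q.[k.+1%:R])%:P) *: ('X^k : I1poly K) = 0.
  by rewrite aE evalH_scaleM weight_Xn scaler0.
rewrite evalHB scalerBl qX evalHC sub0r => /eqP; rewrite oppr_eq0 => /eqP.
move=> /(congr1 (fun r : {poly K} => r`_k)).
rewrite I1poly_scaleE /= coefZ coefXn eqxx mulr1 coef0.
by [].
Qed.

(** This is what makes M(n, l) nonzero, with a generator of exact order [n]. *)
Lemma evalH_I1FH (n : nat) (l : K) (p : {poly K}) :
  evalH p \in I1FH n l -> ('X - l%:P) ^+ n %| p.
Proof.
move=> /asboolP[f [w [fF pE]]].
have [s [P [f' [us f'F wE]]]] := normal_form charK w.
have -> : p = \sum_(j <- s | j == 0) (P j * ('X - l%:P) ^+ n).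
  apply: (symbol_unique (f := f + f' * (I1H K - l%:A) ^+ n)).
    by apply: FD => //; apply: F_right_ideal.
  rewrite pE wE mulrDl addrA mulr_suml; congr (_ + _).
  by apply: eq_bigr => j _; rewrite evalHM evalHXsubC mulrA.
apply: (big_ind (fun q => ('X - l%:P) ^+ n %| q)) => [|a b|j _].
- exact: dvdp0.
- exact: dvdp_add.
- exact: dvdp_mulIr.
Qed.

Variables (n : nat) (l : K).
Local Notation M := (I1M charK n l).

Definition I1M_gen : M := (\pi_M (1 : (I1 K)^o))%qT.

Lemma I1M_piE (r : I1 K) : (\pi_M (r : (I1 K)^o))%qT = r *: I1M_gen.
Proof.
transitivity (quot_scale r I1M_gen); last by [].
by rewrite quot_scale_pi [_ *: _]mulr1.
Qed.

Lemma I1M_generated (m : M) : exists r : I1 K, m = r *: I1M_gen.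
Proof. by exists (repr m); rewrite -I1M_piE reprK. Qed.

Lemma I1M_annihilator (r : I1 K) : r *: I1M_gen = 0 <-> r \in I1FH n l.
Proof.
rewrite -I1M_piE -[0 : M](scale0r I1M_gen) -I1M_piE.
split=> [/eqP|rF]; first by rewrite quot_mod_eq subr0.
by apply/eqP; rewrite quot_mod_eq subr0.
Qed.

Lemma I1M_F (f : I1 K) (m : M) : f \in @I1F K -> f *: m = 0.
Proof.
move=> fF; have [r ->] := I1M_generated m; rewrite scalerA.
apply/I1M_annihilator/asboolP; exists (f * r), 0.
by rewrite mul0r addr0 F_right_ideal.
Qed.

Lemma I1M_nilpotent : evalH (('X - l%:P) ^+ n) *: I1M_gen = 0.
Proof.
apply/I1M_annihilator/asboolP; exists 0, 1.
by rewrite F0 add0r mul1r evalHXsubC.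
Qed.

Lemma I1M_order : (0 < n)%N -> evalH (('X - l%:P) ^+ n.-1) *: I1M_gen != 0.
Proof.
move=> n0; apply/eqP => /I1M_annihilator/evalH_I1FH/dvdp_leq.
rewrite !size_exp_XsubC expf_neq0 ?polyXsubC_eq0 // ltnS => /(_ isT).
by rewrite leqNgt prednK // leqnn.
Qed.

End StandardModule.

(** * Classification *)

Section Classification.
Variables (K : fieldType) (charK : [pchar K] =i pred0) (M : lmodType (I1 K)).
Hypotheses (indM : indecomposable M) (gM : gen_weight M) (flM : finite_length M).

(** The last proper term of a composition series. *)
Lemma finite_length_maximal : exists N : {pred M},
  [/\ submod_closed N, exists m, m \notin N &
      forall L : {pred M}, submod_closed L -> {subset N <= L} ->
        (exists2 m, m \in L & m \notin N) -> forall m, m \in L].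
Proof.
have [n [N [N0 Nn SN Nmax]]] := flM.
case: n => [|n] in Nn SN Nmax *.
  have [[m /eqP m0] _] := indM.
  have : m \in N 0 by rewrite Nn.
  by rewrite N0 inE => /eqP.
have [_ Nsub maxN] := Nmax n (ltnSn n).
exists (N n); split; first exact: SN.
  apply: contrapT => all; apply: Nsub => m _.
  by apply: contrapT => /negP mN; apply: all; exists m.
move=> L SL NL [m mL mN]; have LN : {subset L <= N n.+1} by move=> z _; rewrite Nn.
have [LE|LE] := maxN L SL NL LN; first by rewrite -LE mL in mN.
by move=> z; rewrite LE Nn.
Qed.

(** Outside a maximal submodule [N] there is a vector [v] fixed by [e]: differentiate a
    vector outside [N] until just before it enters [N], and take its constant
    term. It generates a copy of the simple module of polynomials that is not contained
    in [N], hence a complement of [N], so [N] is zero. *)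
Lemma torsion_module : (forall m : M, m \in @torsion K M) ->
  isomorphic M (I1poly K).
Proof.
move=> tM; have [N [SN [m mN] Nmax]] := finite_length_maximal.
have [v [ev vN]] : exists v : M, I1e K 0 0 *: v = v /\ v \notin N.
  have /asboolP[n nm] := tM m.
  elim: n m nm mN => [|n IHn] m nm mN.
    by move: nm mN; rewrite scale1r => ->; rewrite submod0.
  have [dN|dN] := boolP (I1d K *: m \in N); last first.
    by apply: (IHn _ _ dN); rewrite scalerA -exprSr.
  exists (I1e K 0 0 *: m); split.
    by rewrite scalerA {1}e00E mulrBl mul1r -mulrA d_e00 // mulr0 subr0.
  apply: contra mN => eN; rewrite [m]e00_decomp; apply: submodD => //.
  exact: submodZ.
have v0 : v != 0 by apply: contraNneq vN => ->; apply: submod0.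
have SZ := submod_pred1_0 M.
pose C := adjoin (pred1 0 : {pred M}) v.
have SC : submod_closed C by apply: adjoin_closed.
have vC : v \in C by apply: adjoin_gen.
have NC z : z \in N -> z \in C -> z = 0.
  move=> zN /adjoin0P[r zE]; rewrite zE in zN *.
  by rewrite (act_e00_fixed charK ev) (e00_fixed_simple charK ev SN vN zN)
    [evalx 0]rmorph0 scale0r.
have [_ /(_ N C SN SC)] := indM; case=> //.
- have Dall := Nmax (adjoin N v) (adjoin_closed v SN) (@sub_adjoin _ _ N v).
  move=> z; have /asboolP[r rN] : z \in adjoin N v.
    by apply: Dall; exists v => //; apply: adjoin_gen.
  exists (z - r *: v), (r *: v); rewrite subrK; split=> //.
  exact: submodZ.
- move=> N0; apply: (poly_isomorphic charK ev v0) => z.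
  have /asboolP[r] : z \in adjoin N v.
    apply: Nmax (adjoin_closed v SN) (@sub_adjoin _ _ N v) _ _.
    by exists v => //; apply: adjoin_gen.
  by rewrite N0 inE subr_eq0 => /eqP; exists r.
- by move=> C0; move: vC v0; rewrite C0 inE => /eqP ->; rewrite eqxx.
Qed.

(** Shifting a nonzero weight vector gives one with its weight in [Lam]. Finite length
    bounds the order of nilpotency, a vector of maximal order generates the module by
    [jordan_cyclic], and its annihilator is the left ideal that defines M(n, l). *)
Lemma flat_module (Lam : set K) : bij_KmodZ Lam ->
  (forall m : M, m \in @flat K M) ->
  exists (n : nat) (l : K), [/\ (1 <= n)%N, Lam l & isomorphic M (I1M charK n l)].
Proof.
move=> [_ _ surjL] fM.
have FM (f : I1 K) (m : M) : f \in @I1F K -> f *: m = 0 by apply: flat_F.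
have SZ := submod_pred1_0 M.
have [mu [u [wu u0]]] : exists mu (u : M), weight mu u /\ u \notin (pred1 0 : {pred M}).
  apply: weight_generators => // all; have [[m /negP m0] _] := indM.
  by apply: m0; have := all m; rewrite inE.
have [l Ll /eqP lmu] := surjL (\pi_(KmodZ K) mu)%qT I.
have {lmu} /asboolP[j jE] : l - mu \in @Zpred K by rewrite Quotient.idealrBE.
pose z := shift K j *: u.
have z0 : z != 0.
  by apply: contra u0 => z0; apply: (shiftK charK FM SZ (j := j)); rewrite inE.
have wz : weight l z by have := weight_shift charK j wu; rewrite -jE addrC subrK.
have [b bP] := finite_length_bound charK FM flM.
pose kills n := `[< forall y : M, weight l y -> evalH (('X - l%:P) ^+ n) *: y = 0 >].
have ex_kills : exists n, kills n by exists b; apply/asboolP => y; apply: bP.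
case: (ex_minnP ex_kills) => n /asboolP nP nmin.
have n0 : (0 < n)%N.
  case: n nP {nmin} => // nP; case/eqP: z0.
  by have := nP z wz; rewrite expr0 evalH1 scale1r.
have [v [wv v1]] : exists v : M, weight l v /\ evalH (('X - l%:P) ^+ n.-1) *: v != 0.
  apply: contrapT => N; have : kills n.-1.
    apply/asboolP => y wy; apply: contrapT => /eqP y0; apply: N.
    by exists y.
  by move/nmin; rewrite leqNgt prednK // leqnn.
have gen := jordan_cyclic charK FM indM gM (nP v wv) v1 nP.
exists n, l; split=> //.
apply: (cyclic_isomorphic gen (@I1M_generated _ charK n l)) => r.
rewrite (cyclic_annihilator charK FM (nP v wv) v1).
by rewrite I1M_annihilator.
Qed.

End Classification.

(** * Distinguishing the modules of the list *)

Section NonIsomorphism.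
Variables (K : fieldType) (charK : [pchar K] =i pred0).

Lemma poly_not_I1M n l : ~ isomorphic (I1poly K) (I1M charK n l).
Proof.
move=> [f fbij]; have finj := bij_inj fbij.
have : I1e K 0 0 *: ((1 : {poly K}) : I1poly K) = (1 : {poly K}).
  by rewrite e00_poly // coefC.
move=> /(congr1 f); rewrite linearZ /= I1M_F; last exact: Fe.
rewrite -(linear0 f) => /finj/eqP; rewrite eq_sym.
by apply/negP; exact: oner_neq0.
Qed.

(** Weights are preserved by injective homomorphisms, and the order of nilpotency on the
    weight space of [l] does not decrease. *)
Lemma cyclic_hom_invariants (M M' : lmodType (I1 K)) (f : {linear M -> M'})
    n n' l l' (v : M) (v' : M') : injective f -> (0 < n)%N ->
  evalH (('X - l%:P) ^+ n) *: v = 0 -> evalH (('X - l%:P) ^+ n.-1) *: v != 0 ->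
  (forall (r : I1 K) (m : M'), r \in @I1F K -> r *: m = 0) ->
  evalH (('X - l'%:P) ^+ n') *: v' = 0 -> (forall m, exists r : I1 K, m = r *: v') ->
  l - l' \in @Zpred K /\ (l = l' -> (n <= n')%N).
Proof.
move=> finj n0 vn vn1 FM' v'n gen'.
have fv0 : f v != 0.
  rewrite -(linear0 f) (inj_eq finj).
  by apply: contraNneq vn1 => ->; rewrite scaler0.
have wfv : weight l (f v) by exists n; rewrite -linearZ /= vn linear0.
split=> [|ll'].
  by apply: contraNT fv0 => /(cyclic_away charK FM' v'n gen')/(_ wfv)/eqP.
rewrite -ll' in v'n; have := cyclic_weight_bound charK FM' v'n gen' wfv.
rewrite -linearZ /= -(linear0 f) => /finj kv.
have [|/dvdp_leq|] :=
    @evalH_cyclic _ _ _ l n v (('X - l%:P) ^+ n') (submod_pred1_0 M) vn.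
- by rewrite inE kv.
- rewrite !size_exp_XsubC ltnS.
  by apply; rewrite expf_neq0 // polyXsubC_eq0.
- by rewrite inE (negPf vn1).
Qed.

Lemma I1M_iso_invariants n n' l l' : (1 <= n)%N -> (1 <= n')%N ->
  isomorphic (I1M charK n l) (I1M charK n' l') ->
  l - l' \in @Zpred K /\ (l = l' -> n = n').
Proof.
have hom m m' a b (f : {linear I1M charK m a -> I1M charK m' b}) :
    (0 < m)%N -> injective f -> a - b \in @Zpred K /\ (a = b -> (m <= m')%N).
  move=> m0 finj.
  exact: (cyclic_hom_invariants finj m0 (I1M_nilpotent charK m a)
    (I1M_order charK a m0) (@I1M_F _ charK m' b) (I1M_nilpotent charK m' b)
    (@I1M_generated _ charK m' b)).
move=> n0 n'0 iso; have [f /bij_inj finj] := iso.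
have [g /bij_inj ginj] := isomorphic_sym iso.
have [ll' le] := hom _ _ _ _ f n0 finj; have [_ ge] := hom _ _ _ _ g n'0 ginj.
by split=> // eql; apply/eqP; rewrite eqn_leq le ?ge.
Qed.

End NonIsomorphism.

Theorem theorem2p5 (K : fieldType) (charK : [pchar K] =i pred0)
    (Lam : set K) (LamP : bij_KmodZ Lam) :
  (* every module in question is in the list *)
  (forall M : lmodType (I1 K),
     indecomposable M -> gen_weight M -> finite_length M ->
     isomorphic M (I1poly K) \/
     exists (n : nat) (l : K),
       [/\ (1 <= n)%N, Lam l & isomorphic M (I1M charK n l)]) /\
  (* the modules in the list are pairwise non-isomorphic *)
  ((forall (n : nat) (l : K), (1 <= n)%N -> Lam l ->
      ~ isomorphic (I1poly K) (I1M charK n l)) /\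
   (forall (n n' : nat) (l l' : K),
      (1 <= n)%N -> Lam l -> (1 <= n')%N -> Lam l' ->
      isomorphic (I1M charK n l) (I1M charK n' l') -> n = n' /\ l = l')) /\
  (* they are indecomposable, generalized weight and of finite length *)
  [/\ indecomposable (I1poly K), gen_weight (I1poly K) &
      finite_length (I1poly K)] /\
  (forall (n : nat) (l : K), (1 <= n)%N -> Lam l ->
     [/\ indecomposable (I1M charK n l), gen_weight (I1M charK n l) &
         finite_length (I1M charK n l)]).
Proof.
split; [|split; [split|split]].
- move=> M indM gM flM.
  have [_ /(_ _ _ (torsion_closed charK M) (@flat_closed _ M))] := indM.
  case=> [||t0|f0].
  + exact: torsion_flat_split.
  + exact: torsion_flat_eq0.
  + right; apply: flat_module => // m.
    have [a [b [aT bF ->]]] := torsion_flat_split charK gM m.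
    by move: aT; rewrite t0 inE => /eqP ->; rewrite add0r.
  + left; apply: torsion_module => // m.
    have [a [b [aT bF ->]]] := torsion_flat_split charK gM m.
    by move: bF; rewrite f0 inE => /eqP ->; rewrite addr0.
- by move=> n l _ _; apply: poly_not_I1M.
- move=> n n' l l' n0 Ll n'0 Ll' iso.
  have [ll' nn'] := I1M_iso_invariants n0 n'0 iso.
  have [_ injL _] := LamP.
  have llE : l = l'.
    by apply: injL; rewrite ?inE //; apply/eqP; rewrite -Quotient.idealrBE.
  by split=> //; apply: nn'.
- split; [exact: indecomposable_poly | exact: gen_weight_poly |].
  exact: finite_length_poly.
- move=> n l n0 _.
  have FM := @I1M_F _ charK n l; have vn := I1M_nilpotent charK n l.
  have vn1 := @I1M_order _ charK n l n0; have gen := @I1M_generated _ charK n l.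
  split.
  + exact (cyclic_indecomposable charK FM vn vn1 gen).
  + exact (cyclic_gen_weight charK FM vn gen).
  + exact (cyclic_finite_length charK FM vn vn1 gen).
Qed.
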